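(* Let $M_{n,1}=2^n$ for $n\ge 1$ and $M_{n,2}=2^n$ for $n\ge 0$, and let $$f(x_1,x_2)=\frac{1}{\sqrt2}\bigl(\cos(2\pi(x_1+x_2))+\cos(4\pi(x_1+x_2))\bigr).$$ For $N\in\mathbb{N}$ let $X_N=(X_{n,n'})_{1\le n,n'\le N}$ be the symmetric random matrix with $$X_{n,n'}=\frac{1}{\sqrt N}\,f\bigl(M_{n+n',1}x_1,\;M_{|n-n'|,2}x_2\bigr),\qquad n,n'\in\{1,\ldots,N\},$$ where $(x_1,x_2)$ is distributed according to Lebesgue measure on $[0,1)^2$. Then, as $N\to\infty$, the mean empirical eigenvalue distribution of $X_N$ does not converge weakly to a semicircle law; that is, for no $R>0$ does it converge weakly to the probability measure with density $\frac{2}{\pi R^2}\sqrt{R^2-x^2}\,\mathbf{1}_{x^2\le R^2}$.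
   Context: The probability space is $[0,1)^2$ with Lebesgue measure. The mean empirical eigenvalue distribution of $X_N$ is the expectation of the measure $\frac1N\sum_{i=1}^N\delta_{\lambda_i}$, where $\lambda_1,\dots,\lambda_N$ are the eigenvalues of $X_N$. *)

(* Defs.v *)
From HB Require Import structures.
From mathcomp Require Import all_boot all_order all_algebra.
From mathcomp Require Import all_classical all_reals all_analysis.
From mathcomp Require Import complex.

Set Implicit Arguments.
Unset Strict Implicit.
Unset Printing Implicit Defensive.

Import Order.TTheory GRing.Theory Num.Theory.
Import numFieldNormedType.Exports.

Local Open Scope classical_set_scope.
Local Open Scope ring_scope.

Section Eigenvalues.
Context {R : rcfType}.

(* Eigenvalues listed with algebraic multiplicity, in an unspecified order;
   [::] when the characteristic polynomial does not split over R. *)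
Definition eigenvalues n (A : 'M[R]_n) : seq R :=
  xget [::] [set s | char_poly A = \prod_(l <- s) ('X - l%:P)].

Lemma sym_char_poly_split n (A : 'M[R]_n) : A^T = A ->
  exists s : seq R, char_poly A = \prod_(l <- s) ('X - l%:P).
Proof.
move=> symA; pose toC := real_complex R; pose AC := map_mx toC A.
have realAC : AC \is a realmx.
  by apply/mxOverP => i j; rewrite mxE; apply/complex_realP; exists (A i j).
have trAC : AC^T = AC by rewrite /AC map_trmx symA.
have hermAC : AC \is hermsymmx.
  apply: realsym_hermsym => //; apply/is_hermitianmxP.
  by rewrite expr0 scale1r map_mx_id.
have /orthomx_spectralP eqAC := hermitian_normalmx hermAC.
have realD := hermitian_spectral_diag_real hermAC.
set P := spectralmx AC in eqAC; set D := spectral_diag AC in eqAC realD.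
have Punit : P \in unitmx := spectral_unit AC.
have DE i : exists l : R, D 0 i = toC l.
  by have /mxOverP/(_ 0 i)/complex_realP := realD.
pose l i := projT1 (cid (DE i)).
have lE i : D 0 i = toC (l i) := projT2 (cid (DE i)).
exists [seq l i | i <- enum 'I_n].
apply: (@map_poly_inj _ _ toC).
rewrite map_char_poly -/AC rmorph_prod /= big_map big_enum /=.
have -> : char_poly AC = char_poly (diag_mx D).
  pose Q := map_mx polyC P; pose Q' := map_mx polyC (invmx P).
  have QQ' : Q *m Q' = 1%:M by rewrite -map_mxM mulmxV // map_mx1.
  have Q'Q : Q' *m Q = 1%:M by rewrite -map_mxM mulVmx // map_mx1.
  have -> : char_poly AC = \det (Q' *m char_poly_mx (diag_mx D) *m Q).
    rewrite /char_poly /char_poly_mx mulmxBr mulmxBl.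
    rewrite scalar_mxC -(mulmxA _ Q' Q) Q'Q mulmx1.
    by rewrite {1}eqAC !map_mxM.
  by rewrite -mulmxA det_mulmx mulrC -det_mulmx -mulmxA QQ' mulmx1.
rewrite char_poly_trig ?diag_mx_is_trig //.
by apply: eq_bigr => i _; rewrite rmorphB /= map_polyX map_polyC mxE eqxx lE.
Qed.

Lemma eigenvaluesP n (A : 'M[R]_n) : A^T = A ->
  char_poly A = \prod_(l <- eigenvalues A) ('X - l%:P).
Proof.
by move=> /sym_char_poly_split[s sP]; rewrite /eigenvalues; case: xgetP => // /(_ s).
Qed.

End Eigenvalues.

Section SpectralDistribution.
Context {R : realType}.
Local Open Scope ereal_scope.

Definition empirical_dist n (A : 'M[R]_n)
    (B : set (measurableTypeR R)) : \bar R :=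
  (n%:R^-1)%:E * \sum_(l <- eigenvalues A) \d_l B.

Definition unit_square : set (R * R) := `[0%R, 1%R[ `*` `[0%R, 1%R[.

(* Expectation, over [0,1)^2 with Lebesgue measure, of the random measure
   [empirical_dist (X x)]. *)
Definition mean_empirical_dist n (X : R * R -> 'M[R]_n)
    (B : set (measurableTypeR R)) : \bar R :=
  \int[lebesgue_measure \x lebesgue_measure]_(x in unit_square)
    empirical_dist (X x) B.

Definition semicircle_pdf (r x : R) : R :=
  if (x ^+ 2 <= r ^+ 2)%R
  then (2 / (pi * r ^+ 2) * Num.sqrt (r ^+ 2 - x ^+ 2))%R else 0%R.

Definition semicircle_law (r : R) (B : set (measurableTypeR R)) : \bar R :=
  \int[lebesgue_measure]_(x in B) (semicircle_pdf r x)%:E.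

(* The arguments are plain set functions: the library's integral is defined at
   this generality, so measures need not be bundled.
   [measurableTypeR R] is [R] with the Borel sets that carry
   [lebesgue_measure]. *)
Definition weakly_converges (mu : nat -> set (measurableTypeR R) -> \bar R)
    (nu : set (measurableTypeR R) -> \bar R) : Prop :=
  forall g : R -> R, continuous g -> (exists M : R, forall x, `|g x| <= M)%R ->
    (fun N => \int[mu N]_x (g x)%:E) @ \oo --> \int[nu]_x (g x)%:E.

End SpectralDistribution.

Section LacunaryMatrix.
Context {R : realType}.

Definition M1 (n : nat) : nat := (2 ^ n)%N.

Definition M2 (n : nat) : nat := (2 ^ n)%N.

Definition f (x1 x2 : R) : R :=
  (Num.sqrt 2)^-1 *
    (cos (2 * pi * (x1 + x2)) + cos (4 * pi * (x1 + x2))).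

(* The ordinals i, j range over 0, ..., N - 1, so the row and column indices
   n, n' of the mathematical text are i.+1, j.+1. *)
Definition X (N : nat) (x : R * R) : 'M[R]_N :=
  \matrix_(i < N, j < N)
    ((Num.sqrt N%:R)^-1 *
      f ((M1 (i.+1 + j.+1))%:R * x.1) ((M2 `|i.+1 - j.+1|%N)%:R * x.2)).

End LacunaryMatrix.

(* Main.v *)
Require Import Defs.
From HB Require Import structures.
From mathcomp Require Import all_boot all_order all_algebra.
From mathcomp Require Import all_classical all_reals all_analysis.
From mathcomp Require Import complex finmap measurable_realfun.
From mathcomp Require Import ring lra zify.
Import Order.TTheory GRing.Theory Num.Theory.
Import numFieldNormedType.Exports.
Local Open Scope ring_scope.

(** Convergence to the semicircle law of radius r would force its variance
    r^2 / 4 to be at most 1/2 and its fourth moment r^4 / 8 to exceed 1/2, which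
    are incompatible.

    Up to the factor N^(-1/2), the entry (i, j) is the sum, divided by sqrt 2,
    of the waves of frequencies v and 2v, where v = (2^(i+j), 2^|i-j|).  Products
    of entries have nonnegative Fourier coefficients, so their means are bounded
    below by keeping any part of the Fourier expansion ([dominates]).  The second
    moment is exactly 1/2 ([mean_mxtrace2]).  In the fourth moment, the closed
    walks i - j - k - l - i with i = k or j = l contribute 1/2 in the limit, as
    for a semicircle of variance 1/2.  But below the diagonal the entries (i, j)
    and (i+1, j) share a wave, because v is doubled when i becomes i + 1; hence
    the walks with k = i + 1 contribute a further 1/48
    ([dominates_two_waves_double], [mean_mxtrace4_ge]).

    To pass the fourth moment to a weak limit, the sixth moments have to be
    bounded.  A closed walk of length six contributes only if some signed sum of
    powers of two, with exponents close to the sums of the end points of its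
    edges, vanishes.  The smallest power must then occur twice, and after
    cancelling or merging the two there is a second coincidence
    ([signed_pow2_sum0_twice]).  These two approximate linear relations are
    independent, which leaves O(N^4) walks ([card_near_closed_walk]).

    On the side of the matrices it suffices to bound from above the integrals of
    nonnegative test functions.  The integral of a nonnegative function is a
    supremum over simple functions, hence superadditive, which bounds the
    integral against the mean distribution by the mean of the integrals
    ([integral_mean_empirical_dist_le]).  The lower bound on the fourth moment is
    used through max(0, L^4 - y^4), which is at most L^4 - y^4 + y^6 / L^2. *)

Set Implicit Arguments.
Unset Strict Implicit.
Unset Printing Implicit Defensive.

(** * Lower integrals and the mean empirical distribution *)

Section LowerIntegral.
Local Open Scope classical_set_scope.
Local Open Scope ereal_scope.
Import HBNNSimple.

Let ge0_funepos_EFin (T : Type) (R : realType) (g : T -> R) :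
  (forall x, 0 <= g x)%R -> (fun x => (g x)%:E)^\+ = (fun x => (g x)%:E).
Proof. by move=> g0; apply/funext => x; rewrite funeposE max_l ?lee_fin. Qed.

Let ge0_funeneg_EFin (T : Type) (R : realType) (g : T -> R) :
  (forall x, 0 <= g x)%R -> (fun x => (g x)%:E)^\- = cst 0.
Proof.
by move=> g0; apply/funext => x; rewrite funenegE max_r // -EFinN lee_fin oppr_le0.
Qed.

(** The integral of a nonnegative function is a supremum of integrals of simple
    functions, so an upper bound for an arbitrary set function can be checked on
    simple functions. *)
Lemma le_integral_setfun d (T : measurableType d) (R : realType)
    (mu : set T -> \bar R) (g : T -> R) (b : \bar R) :
  mu set0 = 0 -> (forall x, 0 <= g x)%R ->
  (forall h : {nnsfun T >-> R}, (forall x, h x <= g x)%R ->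
     sintegral mu h <= b) ->
  \int[mu]_x (g x)%:E <= b.
Proof.
move=> mu0 g0 hb; rewrite /integral patch_setT.
rewrite ge0_funepos_EFin // ge0_funeneg_EFin //.
apply: (@le_trans _ _ (b - 0)); last by rewrite sube0.
apply: leeB.
  by apply/ge_ereal_sup => _ [h /= hg <-]; apply: hb => x; rewrite -lee_fin.
apply: ereal_sup_ubound; exists nnsfun0 => //=.
rewrite /sintegral fsbig1 // => x _.
have [->|x0] := eqVneq x 0%R; first by rewrite mul0e.
by rewrite preimage10 ?mu0 ?mule0//= => -[t _ /esym/eqP]; rewrite (negbTE x0).
Qed.

Lemma ge_integral_setfun d (T : measurableType d) (R : realType)
    (mu : set T -> \bar R) (g : T -> R) (h : {nnsfun T >-> R}) :
  mu set0 = 0 -> (forall x, 0 <= h x <= g x)%R ->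
  sintegral mu h <= \int[mu]_x (g x)%:E.
Proof.
move=> mu0 hg.
have g0 x : (0 <= g x)%R by have /andP[/le_trans] := hg x; apply.
rewrite /integral patch_setT.
rewrite ge0_funepos_EFin // ge0_funeneg_EFin //.
rewrite [X in _ - X](_ : _ = 0) ?sube0.
  by apply: ereal_sup_ubound; exists h => //= x; rewrite lee_fin; case/andP: (hg x).
have s0 (k : {nnsfun T >-> R}) : (forall x, k x = 0)%R -> sintegral mu k = 0.
  move=> k0; rewrite /sintegral fsbig1 // => x _.
  have [->|x0] := eqVneq x 0%R; first by rewrite mul0e.
  rewrite preimage10 ?mu0 ?mule0//= => -[t _ /esym/eqP].
  by rewrite k0 (negbTE x0).
apply/eqP; rewrite eq_le; apply/andP; split.
  apply/ge_ereal_sup => _ [k /= kg <-]; rewrite s0 // => x.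
  by apply/eqP; rewrite eq_le -2!lee_fin kg /= lee_fin.
by apply: ereal_sup_ubound; exists nnsfun0; [move=> x /=|exact: s0].
Qed.

Section Superadditive.
Context d (T : measurableType d) (R : realType) (m : {measure set T -> \bar R}).
Implicit Types (D : set T) (u v : T -> \bar R).

(** The sum of simple functions below u and below v is a simple function below
    u + v.  Lower integrals of arbitrary functions have this inequality; equality
    can fail without measurability. *)
Lemma ge0_integral_superadd D u v :
  (forall x, D x -> 0 <= u x) -> (forall x, D x -> 0 <= v x) ->
  \int[m]_(x in D) u x + \int[m]_(x in D) v x <= \int[m]_(x in D) (u x + v x).
Proof.
move=> u0 v0.
have uv0 x : D x -> 0 <= u x + v x by move=> Dx; rewrite adde_ge0 ?u0 ?v0.
rewrite !ge0_integralE //.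
set A := [set _ | _ in _]; set B := [set _ | _ in _]; set C := [set _ | _ in _].
have A0 : A 0.
  by exists nnsfun0 => /= [x|]; [rewrite erestrict_ge0|exact: sintegral0].
have B0 : B 0.
  by exists nnsfun0 => /= [x|]; [rewrite erestrict_ge0|exact: sintegral0].
have AB a b : A a -> B b -> a + b <= ereal_sup C.
  move=> [h /= hu <-] [k /= kv <-].
  rewrite -sintegralD; apply: ereal_sup_ubound; exists (h \+ k)%R => //= x.
  rewrite EFinD; apply: (le_trans (leeD (hu x) (kv x))).
  by rewrite !patchE; case: ifP => // _; rewrite adde0.
have C0 : 0 <= ereal_sup C by rewrite -[0]adde0; exact: AB.
have [Coo|] := eqVneq (ereal_sup C) +oo; first by rewrite Coo leey.
move=> Coo; have Cfin : ereal_sup C \is a fin_num.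
  by rewrite ge0_fin_numE // ltey.
have BC b : B b -> b \is a fin_num.
  move=> Bb; have b0 : 0 <= b by case: Bb => h _ <-; exact: sintegral_ge0.
  rewrite ge0_fin_numE //; apply: (@le_lt_trans _ _ (ereal_sup C)).
    by rewrite -[b]add0e; exact: AB.
  by rewrite ltey.
have supA b : B b -> ereal_sup A + b <= ereal_sup C.
  move=> Bb; rewrite -leeBrDr ?BC //; apply/ge_ereal_sup => a Aa.
  by rewrite leeBrDr ?BC //; exact: AB.
have Afin : ereal_sup A \is a fin_num.
  rewrite ge0_fin_numE; last exact: ereal_sup_ubound.
  apply: (@le_lt_trans _ _ (ereal_sup C)); last by rewrite ltey.
  by rewrite -[leLHS]adde0; exact: supA.
rewrite addeC -leeBrDr //; apply/ge_ereal_sup => b Bb.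
by rewrite leeBrDr // addeC; exact: supA.
Qed.

Lemma ge0_integral_superlinear D (c : R) u : (0 <= c)%R ->
  (forall x, D x -> 0 <= u x) ->
  c%:E * \int[m]_(x in D) u x <= \int[m]_(x in D) (c%:E * u x).
Proof.
rewrite le_eqVlt => /predU1P[<- u0|c0 u0].
  by rewrite mul0e; apply: integral_ge0 => x _; rewrite mul0e.
have cu0 x : D x -> 0 <= c%:E * u x.
  by move=> Dx; rewrite mule_ge0 ?u0 // lee_fin ltW.
rewrite -lee_pdivlMl // !ge0_integralE //.
apply/ge_ereal_sup => _ [h /= hu <-].
rewrite lee_pdivlMl //.
pose k := mul_nnsfun (cst_nnsfun T (NngNum (ltW c0))) h.
rewrite -(sintegralrM m c h).
apply: ereal_sup_ubound; exists k => //= x.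
rewrite EFinM /=; apply: (@le_trans _ _ (c%:E * (u \_ D) x)).
  by rewrite lee_pmul2l // lte_fin.
by rewrite !patchE; case: ifP => // _; rewrite mule0.
Qed.

Lemma ge0_integral_sum_superadd D (I : Type) (s : seq I) (c : I -> R)
    (u : I -> T -> \bar R) :
  (forall i, 0 <= c i)%R -> (forall i x, D x -> 0 <= u i x) ->
  \sum_(i <- s) (c i)%:E * \int[m]_(x in D) u i x <=
  \int[m]_(x in D) \sum_(i <- s) (c i)%:E * u i x.
Proof.
move=> c0 u0.
have cu0 i x : D x -> 0 <= (c i)%:E * u i x.
  by move=> Dx; rewrite mule_ge0 ?u0 ?lee_fin.
elim: s => [|i s IH].
  by rewrite big_nil; apply: integral_ge0 => x _; rewrite big_nil.
rewrite big_cons; under [leRHS]eq_integral do rewrite big_cons.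
apply: le_trans (ge0_integral_superadd _ _); last 2 first.
- by move=> x; exact: cu0.
- by move=> x Dx; apply: sume_ge0 => j _; exact: cu0.
by apply: leeD => //; apply: ge0_integral_superlinear => // x; exact: u0.
Qed.

Lemma ge0_le_integral_nomeas D u v :
  (forall x, D x -> 0 <= u x) -> (forall x, D x -> u x <= v x) ->
  \int[m]_(x in D) u x <= \int[m]_(x in D) v x.
Proof.
move=> u0 uv.
have v0 x : D x -> 0 <= v x by move=> Dx; rewrite (le_trans (u0 _ Dx)) ?uv.
rewrite !ge0_integralE //; apply/ge_ereal_sup => _ [h /= hu <-].
apply: ereal_sup_ubound; exists h => //= x; apply: (le_trans (hu x)).
by rewrite !patchE; case: ifPn => // /set_mem /uv.
Qed.

End Superadditive.

Lemma empirical_dist_ge0 (R : realType) n (A : 'M[R]_n) B :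
  0 <= empirical_dist A B.
Proof.
by rewrite mule_ge0 ?lee_fin ?invr_ge0 ?ler0n //; apply: sume_ge0.
Qed.

(** For a simple function below g, the integral is a finite combination of lower
    integrals over the square, which superadditivity gathers under one integral
    sign, where it is the average of the simple function over the spectrum. *)
Lemma integral_mean_empirical_dist_le (R : realType) n
    (X : R * R -> 'M[R]_n) (g : R -> R) (G : R * R -> R) :
  (forall y, 0 <= g y)%R ->
  (forall x, unit_square x ->
     n%:R^-1 * \sum_(l <- eigenvalues (X x)) g l <= G x)%R ->
  \int[mean_empirical_dist X]_y (g y)%:E <=
  \int[lebesgue_measure \x lebesgue_measure]_(x in unit_square) (G x)%:E.
Proof.
move=> g0 gG.
have mu0 : mean_empirical_dist X set0 = 0.
  rewrite /mean_empirical_dist integral0_eq // => x _.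
  rewrite /empirical_dist big1 ?mule0 // => l _; exact: measure0.
apply: le_integral_setfun => //.
move=> h hg; rewrite /sintegral.
have hfin : finite_set (range h) by [].
(* The truncation changes no value of h, and makes every weight nonnegative. *)
rewrite (_ : \sum_(_ \in _) _ = \sum_(y <- fset_set (range h))
    (Num.max 0 y)%:E * mean_empirical_dist X (h @^-1` [set y])); last first.
  rewrite -(fsbig_widen (range h)) //=; last first.
    by move=> y [_ Ny] /=; rewrite (preimage10 Ny) mu0 mule0.
  rewrite fsbig_finite //=; apply: eq_big_seq => y.
  rewrite in_fset_set // => /set_mem[t _ <-].
  by rewrite max_r.
apply: (le_trans (ge0_integral_sum_superadd _ _ _ _)).
- by move=> y; rewrite le_max lexx.
- by move=> *; exact: empirical_dist_ge0.
apply: ge0_le_integral_nomeas => x xsq.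
  apply: sume_ge0 => y _; rewrite mule_ge0 ?empirical_dist_ge0 //.
  by rewrite lee_fin le_max lexx.
apply: (@le_trans _ _ (n%:R^-1 * \sum_(l <- eigenvalues (X x)) g l)%:E); last first.
  by rewrite lee_fin gG.
rewrite EFinM /empirical_dist.
under eq_bigr => y _.
  rewrite muleCA; over.
rewrite -ge0_sume_distrr; last first.
  move=> y _; rewrite mule_ge0 ?lee_fin ?le_max ?lexx //.
  by apply: sume_ge0.
apply: lee_wpmul2l; first by rewrite lee_fin invr_ge0.
under eq_bigr => y _.
  rewrite ge0_sume_distrr //; over.
rewrite exchange_big /= -sumEFin; apply: lee_sum => l _.
rewrite (bigD1_seq (h l)) ?fset_uniq //=; last first.
  by rewrite in_fset_set //; apply/mem_set; exists l.
rewrite big1 ?adde0 => [|y yl].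
  by rewrite diracE mem_set // mule1 lee_fin max_r.
by rewrite diracE memNset ?mule0 //= => /esym /eqP; rewrite (negbTE yl).
Qed.

End LowerIntegral.

(** * Integration against the semicircle law *)

Section PointwiseContinuity.
Local Open Scope classical_set_scope.
Context {T : topologicalType} {R : realType}.
Implicit Types f g : T -> R.

Lemma continuous_add f g :
  continuous f -> continuous g -> continuous (fun x => f x + g x).
Proof. by move=> cf cg x; apply: cvgD; [exact: cf|exact: cg]. Qed.

Lemma continuous_sub f g :
  continuous f -> continuous g -> continuous (fun x => f x - g x).
Proof. by move=> cf cg x; apply: cvgB; [exact: cf|exact: cg]. Qed.

Lemma continuous_mul f g :
  continuous f -> continuous g -> continuous (fun x => f x * g x).
Proof. by move=> cf cg x; apply: cvgM; [exact: cf|exact: cg]. Qed.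

Lemma continuous_pow f n : continuous f -> continuous (fun x => f x ^+ n).
Proof.
move=> cf x; apply: (@continuous_comp _ _ _ f (fun y => y ^+ n)); first exact: cf.
exact: exprn_continuous.
Qed.

Lemma continuous_const (c : R) : continuous (fun _ : T => c).
Proof. by move=> x; exact: cst_continuous. Qed.

End PointwiseContinuity.

Section Semicircle.
Local Open Scope classical_set_scope.
Import HBNNSimple.
Context {R : realType}.
Variable r : R.
Hypothesis r0 : 0 < r.
Implicit Types (x a b d : R).

Definition halfdisk_height x := Num.sqrt (r ^+ 2 - x ^+ 2).
Local Notation w := halfdisk_height.

Lemma semicircle_pdfE x : semicircle_pdf r x = 2 / (pi * r ^+ 2) * w x.
Proof.
rewrite /semicircle_pdf /halfdisk_height; case: ifPn => //; rewrite -ltNge => rx.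
by rewrite ler0_sqrtr ?mulr0 // subr_le0 ltW.
Qed.

Lemma semicircle_pdf_ge0 x : 0 <= semicircle_pdf r x.
Proof.
rewrite semicircle_pdfE mulr_ge0 ?sqrtr_ge0 // divr_ge0 //.
by rewrite mulr_ge0 ?pi_ge0 // sqr_ge0.
Qed.

Lemma continuous_halfdisk_height : continuous w.
Proof.
move=> x; apply: (@continuous_comp _ _ _ (fun x => r ^+ 2 - x ^+ 2) Num.sqrt).
  apply: continuous_sub; first exact: continuous_const.
  exact: exprn_continuous.
exact: sqrt_continuous.
Qed.

Lemma continuous_semicircle_pdf : continuous (semicircle_pdf r).
Proof.
rewrite (_ : semicircle_pdf r = fun x => 2 / (pi * r ^+ 2) * w x); last first.
  by apply/funext => x; exact: semicircle_pdfE.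
apply: continuous_mul; first exact: continuous_const.
exact: continuous_halfdisk_height.
Qed.

(** The arcsine of the usual primitive is written 2 atan(x / (r + w)), which is
    continuous up to the end points x = r and x = - r. *)
Definition halfdisk_area_primitive x :=
  (x * w x + 2 * r ^+ 2 * atan (x / (r + w x))) / 2.

Lemma halfdisk_height_gt0 x : - r < x < r -> 0 < w x.
Proof.
by move=> /andP[rx xr]; rewrite sqrtr_gt0 subr_gt0; nra.
Qed.

Lemma sqr_halfdisk_height x : - r <= x <= r -> w x ^+ 2 = r ^+ 2 - x ^+ 2.
Proof.
by move=> /andP[rx xr]; rewrite sqr_sqrtr // subr_ge0; nra.
Qed.

Lemma is_derive_halfdisk_height x : - r < x < r ->
  is_derive x 1 w (- x / w x).
Proof.
move=> rxr; have w0 := halfdisk_height_gt0 rxr.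
have arg0 : 0 < r ^+ 2 - x ^+ 2 by rewrite -sqrtr_gt0.
have D1 : is_derive x 1 (fun x : R => r ^+ 2 - x ^+ 2) (- (2 * x)).
  apply: is_derive_eq; rewrite /GRing.scale /=; ring.
have D2 := is_derive1_sqrt arg0.
have D3 := @is_derive1_comp _ Num.sqrt (fun x => r ^+ 2 - x ^+ 2) _ _ _ D2 D1.
apply: (is_derive_eq D3).
rewrite /GRing.scale /= -/(w x); field; exact: lt0r_neq0.
Qed.

Lemma halfdisk_denominator_gt0 x : 0 < r + w x.
Proof. by rewrite ltr_wpDr ?sqrtr_ge0. Qed.

Lemma is_derive_halfdisk_area_primitive x : - r < x < r ->
  is_derive x 1 halfdisk_area_primitive (w x).
Proof.
move=> rxr; have w0 := halfdisk_height_gt0 rxr.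
have Dw := is_derive_halfdisk_height rxr.
have rw0 : r + w x != 0 by apply/lt0r_neq0/halfdisk_denominator_gt0.
have Dden : is_derive x 1 (fun x => r + w x) (- x / w x).
  by apply: (is_derive_eq (is_deriveD (is_derive_cst r x 1) Dw)); rewrite add0r.
have Dinv := @is_deriveV _ (fun x => r + w x) x _ 1 rw0 Dden.
have Dq : is_derive x 1 (fun x => x / (r + w x)) (r / (w x * (r + w x))).
  apply: (is_derive_eq (is_deriveM (is_derive_id x 1) Dinv)).
  rewrite /GRing.scale /=.
  transitivity ((x ^+ 2 + r * w x + w x ^+ 2) / (w x * (r + w x) ^+ 2)).
    by field; rewrite rw0 lt0r_neq0.
  rewrite sqr_halfdisk_height; last by case/andP: rxr => *; rewrite !ltW.
  by field; rewrite rw0 lt0r_neq0.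
have Da := @is_derive1_comp _ atan (fun x => x / (r + w x)) _ _ _ (is_derive1_atan _) Dq.
have D := is_deriveM (is_deriveD (is_deriveM (is_derive_id x 1) Dw)
  (is_deriveM (is_derive_cst (2 * r ^+ 2) x 1) Da)) (is_derive_cst (2^-1 : R) x 1).
apply: (is_derive_eq D); rewrite /GRing.scale /=.
have x2 : x ^+ 2 = r ^+ 2 - w x ^+ 2.
  by rewrite sqr_halfdisk_height; [ring|case/andP: rxr => *; rewrite !ltW].
(* (r + w)^2 + x^2 = 2 r (r + w) because x^2 + w^2 = r^2. *)
have e : 1 + (x / (r + w x)) ^+ 2 = 2 * r / (r + w x).
  transitivity (((r + w x) ^+ 2 + x ^+ 2) / (r + w x) ^+ 2); first by field.
  by rewrite x2; field.
rewrite e.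
transitivity (2^-1 * (w x - x ^+ 2 / w x + r ^+ 2 / w x)); last first.
  by rewrite x2; field; rewrite lt0r_neq0.
by field; rewrite rw0 !lt0r_neq0.
Qed.

(** The identity (k + 3) x^(k+1) w = k r^2 x^(k-1) w - (x^k w^3)' reduces the
    even moments of the half-disk to its area. *)
Definition moment_primitive a b d x :=
  (a + b * (r ^+ 2 / 4) + d * (r ^+ 4 / 8)) * halfdisk_area_primitive x -
  (b / 4 + d * r ^+ 2 / 8) * (x * w x ^+ 3) - d / 6 * (x ^+ 3 * w x ^+ 3).

Lemma is_derive_moment_primitive a b d x : - r < x < r ->
  is_derive x 1 (moment_primitive a b d) ((a + b * x ^+ 2 + d * x ^+ 4) * w x).
Proof.
move=> rxr; have w0 := halfdisk_height_gt0 rxr.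
have Dw3 := is_deriveX 2%N.+1 (is_derive_halfdisk_height rxr).
have DA := is_derive_halfdisk_area_primitive rxr.
have Dx := is_derive_id x (1 : R).
have D := is_deriveB (is_deriveB
  (is_deriveM (is_derive_cst (a + b * (r ^+ 2 / 4) + d * (r ^+ 4 / 8)) x 1) DA)
  (is_deriveM (is_derive_cst (b / 4 + d * r ^+ 2 / 8) x 1) (is_deriveM Dx Dw3)))
  (is_deriveM (is_derive_cst (d / 6) x 1) (is_deriveM (is_deriveX 3%N Dx) Dw3)).
apply: (is_derive_eq D); rewrite /GRing.scale /= !fctE /=.
transitivity ((a + b * (r ^+ 2 / 4) + d * (r ^+ 4 / 8)) * w x -
    (b / 4 + d * r ^+ 2 / 8) * (w x * (w x ^+ 2 - 3 * x ^+ 2)) -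
    d / 6 * (w x * x ^+ 2 * (3 * w x ^+ 2 - 3 * x ^+ 2))).
  by field; rewrite lt0r_neq0.
rewrite sqr_halfdisk_height; last by case/andP: rxr => *; rewrite !ltW.
by field.
Qed.

Lemma continuous_halfdisk_area_primitive : continuous halfdisk_area_primitive.
Proof.
have cw := continuous_halfdisk_height.
have cid : continuous (fun x : R => x) by move=> x; exact: cvg_id.
apply: continuous_mul; last exact: continuous_const.
apply: continuous_add; first exact: continuous_mul.
apply: continuous_mul; first exact: continuous_const.
move=> x; apply: (@continuous_comp _ _ _ (fun x => x / (r + w x)) atan).
  have cden : continuous (fun x => r + w x).
    by apply: continuous_add => //; exact: continuous_const.
  apply: (continuous_mul cid) => y.
  apply: (@continuousV _ _ (fun x => r + w x)); last exact: cden.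
  exact/lt0r_neq0/halfdisk_denominator_gt0.
exact: continuous_atan.
Qed.

Lemma continuous_moment_primitive a b d : continuous (moment_primitive a b d).
Proof.
have cw := continuous_halfdisk_height.
have cid : continuous (fun x : R => x) by move=> x; exact: cvg_id.
apply: continuous_sub.
  apply: continuous_sub; apply: continuous_mul; try exact: continuous_const.
    exact: continuous_halfdisk_area_primitive.
  by apply: continuous_mul => //; exact: continuous_pow.
apply: continuous_mul; first exact: continuous_const.
by apply: continuous_mul; exact: continuous_pow.
Qed.

Lemma integral_semicircle_moments a b d :
  (\int[lebesgue_measure]_(x in `[(- r)%R, r])
     ((a + b * x ^+ 2 + d * x ^+ 4) * semicircle_pdf r x)%:E =
   (a + b * (r ^+ 2 / 4) + d * (r ^+ 4 / 8))%:E)%E.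
Proof.
have cid : continuous (fun x : R => x) by move=> x; exact: cvg_id.
pose c := 2 / (pi * r ^+ 2).
pose F x := c * moment_primitive a b d x.
have cF : continuous F.
  apply: continuous_mul; first exact: continuous_const.
  exact: continuous_moment_primitive.
have DF x : - r < x < r ->
    is_derive x 1 F ((a + b * x ^+ 2 + d * x ^+ 4) * semicircle_pdf r x).
  move=> rxr; apply: (is_derive_eq
    (is_deriveM (is_derive_cst c x 1) (is_derive_moment_primitive a b d rxr))).
  by rewrite semicircle_pdfE -/c /GRing.scale /=; ring.
rewrite (@continuous_FTC2 _ _ F).
- rewrite -EFinB /F /moment_primitive /halfdisk_area_primitive.
  have wr : w r = 0 by rewrite /halfdisk_height subrr sqrtr0.
  have wNr : w (- r) = 0 by rewrite /halfdisk_height sqrrN subrr sqrtr0.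
  rewrite wr wNr !addr0 !mulNr divff ?lt0r_neq0 // atanN atan1 /c.
  congr EFin.
  have: pi != 0 :> R by rewrite lt0r_neq0 ?pi_gt0.
  by move: pi => q q0; field; rewrite q0 lt0r_neq0.
- by rewrite gtrN.
- apply: continuous_subspaceT; apply: continuous_mul; last exact: continuous_semicircle_pdf.
  apply: continuous_add; first apply: continuous_add.
  + exact: continuous_const.
  + by apply: continuous_mul; [exact: continuous_const|exact: continuous_pow].
  + by apply: continuous_mul; [exact: continuous_const|exact: continuous_pow].
- split.
  + by move=> x; rewrite in_itv /= => /DF[].
  + by apply: cvg_at_right_filter; exact: cF.
  + by apply: cvg_at_left_filter; exact: cF.
- by move=> x; rewrite in_itv /= => /DF D; rewrite derive1E; exact: derive_val.
Qed.

Let p := semicircle_pdf r.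

Let mp : measurable_fun setT p.
Proof. by apply: continuous_measurable_fun; exact: continuous_semicircle_pdf. Qed.

Lemma sintegral_semicircle_law (h : {nnsfun measurableTypeR R >-> R}) :
  (sintegral (semicircle_law r) h =
   \int[lebesgue_measure]_x (h x * p x)%:E)%E.
Proof.
have m0 : semicircle_law r set0 = 0%E by rewrite /semicircle_law integral_set0.
have hfin : finite_set (range h) by [].
rewrite /sintegral -(fsbig_widen (range h)) //=; last first.
  by move=> y [_ Ny] /=; rewrite (preimage10 Ny) m0 mule0.
rewrite fsbig_finite //=.
transitivity (\int[lebesgue_measure]_x \sum_(y <- fset_set (range h))
    (Num.max 0 y * (\1_(h @^-1` [set y]) x * p x))%:E)%E.
  rewrite ge0_integral_sum //; last 2 first.
  - move=> y; apply/measurable_EFinP; apply: measurable_funM => //.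
    exact: measurable_funM.
  - move=> y x _; rewrite lee_fin !mulr_ge0 ?le_max ?lexx //.
    exact: semicircle_pdf_ge0.
  apply: eq_big_seq => y; rewrite in_fset_set // => /set_mem[t _ <-].
  rewrite max_r //; under [RHS]eq_integral do rewrite EFinM.
  rewrite ge0_integralZl_EFin //; last 2 first.
  - by move=> x _; rewrite lee_fin mulr_ge0 //; exact: semicircle_pdf_ge0.
  - by apply/measurable_EFinP; exact: measurable_funM.
  congr (_ * _)%E; rewrite /semicircle_law.
  transitivity (\int[lebesgue_measure]_x ((EFin \o p) \_ (h @^-1` [set h t]) x))%E.
    exact: integral_mkcond.
  apply: eq_integral => x _; rewrite patchE indicE.
  by case: ifPn => _; rewrite ?mul1r ?mul0r.
apply: eq_integral => x _.
rewrite (bigD1_seq (h x)) ?fset_uniq //=; last first.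
  by rewrite in_fset_set //; apply/mem_set; exists x.
rewrite big1 ?adde0 => [|y yx].
  by rewrite max_r // indicE mem_set // mul1r.
by rewrite indicE memNset ?mul0r ?mulr0 //= => /esym /eqP; rewrite (negbTE yx).
Qed.

(** The simple functions increasing to g have the same integral against the law
    and against its density; monotone convergence is applied on the density side. *)
Lemma integral_semicircle_law_ge (g : R -> R) :
  (forall x, 0 <= g x) -> continuous g ->
  (\int[lebesgue_measure]_(x in `[(- r)%R, r]) (g x * p x)%:E <=
   \int[semicircle_law r]_x (g x)%:E)%E.
Proof.
move=> g0 cg.
have m0 : semicircle_law r set0 = 0%E by rewrite /semicircle_law integral_set0.
have mg : measurable_fun [set: measurableTypeR R] (EFin \o g).
  by apply/measurable_EFinP; exact: continuous_measurable_fun.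
pose h := nnsfun_approx measurableT mg.
have eg0 x : setT x -> (0 <= (EFin \o g) x)%E by rewrite lee_fin.
have cvh x : EFin \o h^~ x @ \oo --> (g x)%:E by exact: cvg_nnsfun_approx.
have ndh x : nondecreasing_seq (h^~ x).
  by move=> m n mn; have /lefP/(_ x) := nd_nnsfun_approx measurableT mg mn.
have hg n x : h n x <= g x.
  rewrite -lee_fin; have nde : {homo EFin \o h^~ x : m n / (m <= n)%N >-> (m <= n)%E}.
    by move=> m k mk /=; rewrite lee_fin; exact: ndh.
  rewrite (cvg_unique _ (cvh x) (ereal_nondecreasing_cvgn nde)) //.
  by apply: ereal_sup_ubound; exists n.
have p0 := semicircle_pdf_ge0.
apply: (@le_trans _ _ (\int[lebesgue_measure]_x (g x * p x)%:E)%E).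
  apply: ge0_subset_integral => //.
    by apply/measurable_EFinP; apply: measurable_funM => //; exact/measurable_EFinP.
  by move=> x _; rewrite lee_fin mulr_ge0 ?p0.
have -> : (\int[lebesgue_measure]_x (g x * p x)%:E =
    limn (fun n => \int[lebesgue_measure]_x (h n x * p x)%:E))%E.
  rewrite -monotone_convergence //.
  - apply: eq_integral => x _; apply/esym/cvg_lim => //.
    rewrite EFinM muleC; under eq_fun do rewrite EFinM muleC.
    by apply: cvgeZl => //; exact: cvh.
  - by move=> n; apply/measurable_EFinP; exact: measurable_funM.
  - by move=> n x _; rewrite lee_fin mulr_ge0 ?p0.
  - by move=> x _ m n mn; rewrite lee_fin ler_wpM2r ?p0 // ndh.
apply: lime_le.
  apply: ereal_nondecreasing_is_cvgn => m n mn; apply: ge0_le_integral_nomeas => x _.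
    by rewrite lee_fin mulr_ge0 ?p0.
  by rewrite lee_fin ler_wpM2r ?p0 // ndh.
apply: nearW => n; rewrite -sintegral_semicircle_law.
by apply: ge_integral_setfun => // x; rewrite hg andbT.
Qed.

End Semicircle.

(** * Power sums of eigenvalues and closed walks *)

Section PowerSums.
Local Open Scope classical_set_scope.

(** The spectral theorem conjugates A to a diagonal matrix over R[i]; the
    diagonal entries and the listed eigenvalues are the roots, with
    multiplicity, of the same characteristic polynomial. *)
Lemma sum_eigenvalues_exp (R : rcfType) n (A : 'M[R]_n) k : A^T = A ->
  \sum_(l <- eigenvalues A) l ^+ k = \tr (A ^+ k).
Proof.
move=> symA; pose toC := real_complex R; pose AC := map_mx toC A.
have realAC : AC \is a realmx.
  by apply/mxOverP => i j; rewrite mxE; apply/complex_realP; exists (A i j).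
have trAC : AC^T = AC by rewrite /AC map_trmx symA.
have hermAC : AC \is hermsymmx.
  apply: realsym_hermsym => //; apply/is_hermitianmxP.
  by rewrite expr0 scale1r map_mx_id.
have /orthomx_spectralP eqAC := hermitian_normalmx hermAC.
set P := spectralmx AC in eqAC; set D := spectral_diag AC in eqAC.
have Punit : P \in unitmx := spectral_unit AC.
have charD : char_poly AC = \prod_(i < n) ('X - (D 0 i)%:P).
  pose Q := map_mx polyC P; pose Q' := map_mx polyC (invmx P).
  have QQ' : Q *m Q' = 1%:M by rewrite -map_mxM mulmxV // map_mx1.
  have Q'Q : Q' *m Q = 1%:M by rewrite -map_mxM mulVmx // map_mx1.
  have -> : char_poly AC = \det (Q' *m char_poly_mx (diag_mx D) *m Q).
    rewrite /char_poly /char_poly_mx mulmxBr mulmxBl.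
    rewrite scalar_mxC -(mulmxA _ Q' Q) Q'Q mulmx1.
    by rewrite {1}eqAC !map_mxM.
  rewrite -mulmxA det_mulmx mulrC -det_mulmx -mulmxA QQ' mulmx1.
  rewrite -/(char_poly _) char_poly_trig ?diag_mx_is_trig //.
  by apply: eq_bigr => i _; rewrite mxE eqxx.
(* Equal products of linear factors have the same roots up to order. *)
have /prod_XsubC_eq roots : \prod_(l <- map toC (eigenvalues A)) ('X - l%:P) =
    \prod_(l <- [seq D 0 i | i <- enum 'I_n]) ('X - l%:P).
  rewrite big_map big_map big_enum /= -charD -map_char_poly eigenvaluesP //.
  rewrite rmorph_prod; apply: eq_bigr => l _.
  by rewrite rmorphB /= map_polyX map_polyC.
have powAC m : AC ^+ m = invmx P *m (diag_mx D) ^+ m *m P.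
  elim: m => [|m IH]; first by rewrite !expr0 mulmx1 mulVmx.
  rewrite exprS IH {1}eqAC exprS -!mulmxE !mulmxA.
  by rewrite -(mulmxA _ P (invmx P)) mulmxV // mulmx1.
have mapX m : map_mx toC (A ^+ m) = AC ^+ m.
  elim: m => [|m IH]; first exact: map_mx1.
  by rewrite !exprS -!mulmxE map_mxM IH.
have powD m : (diag_mx D) ^+ m = diag_mx (\row_i D 0 i ^+ m).
  elim: m => [|m IH].
    by apply/matrixP => i j; rewrite expr0 !mxE; case: eqP => [->|]//=.
  rewrite exprS IH -mulmxE; apply/matrixP => i j; rewrite mul_diag_mx !mxE.
  by rewrite exprS; case: eqP => [->|]; rewrite ?mulr1n ?mulr0n ?mulr0.
apply: (@complexI R); rewrite (raddf_sum (real_complex R)) /=.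
transitivity (\sum_(z <- map toC (eigenvalues A)) z ^+ k).
  by rewrite big_map; apply: eq_bigr => l _; rewrite rmorphXn.
rewrite (perm_big _ roots) /= big_map big_enum /=.
transitivity (\tr (AC ^+ k)); last first.
  by rewrite -trace_map_mx mapX.
rewrite powAC mxtrace_mulC mulmxA mulmxV // mul1mx powD mxtrace_diag.
by apply: eq_bigr => i _; rewrite mxE.
Qed.

Lemma mxtrace2E (R : pzRingType) n (A : 'M[R]_n) :
  \tr (A ^+ 2) = \sum_i \sum_j A i j * A j i.
Proof. by apply: eq_bigr => i _; rewrite expr2 -mulmxE mxE. Qed.

Lemma mxtrace4E (R : comPzRingType) n (A : 'M[R]_n) :
  \tr (A ^+ 4) = \sum_i \sum_k \sum_j \sum_l A i j * A j k * (A k l * A l i).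
Proof.
rewrite (exprM A 2 2) mxtrace2E; apply: eq_bigr => i _; apply: eq_bigr => k _.
rewrite expr2 -mulmxE !mxE mulr_suml; apply: eq_bigr => j _.
by rewrite mulr_sumr.
Qed.

Lemma mxtrace6E (R : comPzRingType) n (A : 'M[R]_n) :
  \tr (A ^+ 6) = \sum_i0 \sum_i3 \sum_i1 \sum_i2 \sum_i4 \sum_i5
    A i0 i1 * A i1 i2 * A i2 i3 * (A i3 i4 * A i4 i5 * A i5 i0).
Proof.
have A3 i j : (A ^+ 3) i j = \sum_k \sum_l A i k * A k l * A l j.
  rewrite exprS expr2 -!mulmxE mxE; apply: eq_bigr => k _.
  by rewrite mxE mulr_sumr; apply: eq_bigr => l _; rewrite mulrA.
rewrite (exprM A 3 2) mxtrace2E; apply: eq_bigr => i0 _; apply: eq_bigr => i3 _.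
rewrite !A3 mulr_suml; apply: eq_bigr => i1 _; rewrite mulr_suml.
by apply: eq_bigr => i2 _; rewrite mulr_sumr; apply: eq_bigr => i4 _; rewrite mulr_sumr.
Qed.

End PowerSums.

(** * Trigonometric polynomials with nonnegative coefficients *)

Section TrigonometricPolynomials.
Local Open Scope classical_set_scope.
Context {R : realType}.
Local Notation P := (lebesgue_measure \x lebesgue_measure)%E.
Local Notation sq := (@unit_square R).
Implicit Types (a b : int) (x : R * R).

Lemma sinD_2pi_int (t : R) a : sin (t + 2 * pi * a%:~R) = sin t.
Proof.
have sinDn s n : sin (s + 2 * pi * n%:R) = sin s :> R.
  transitivity (sin (s + pi *+ 2 *+ n)); last exact: (periodicn (@sinD2pi R)).
  by rewrite -(mulr_natl pi 2) -(mulr_natr (2 * pi) n).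
case: a => n; first exact: sinDn.
by rewrite NegzE mulrNz mulrN -(sinDn (t - _) n.+1) subrK.
Qed.

Lemma integral_cos_period a (t : R) : a != 0 ->
  (\int[lebesgue_measure]_(y in `[0%R, 1%R[) (cos (2 * pi * a%:~R * y + t))%:E = 0)%E.
Proof.
move=> a0; pose w : R := 2 * pi * a%:~R.
have w0 : w != 0.
  by rewrite !mulf_neq0 ?intr_eq0 ?pnatr_eq0 // lt0r_neq0 // pi_gt0.
have cf : continuous (fun y : R => cos (w * y + t)).
  move=> y; apply: (@continuous_comp _ _ _ (fun y => w * y + t) cos).
    apply: cvgD; last exact: cvg_cst.
    by apply: cvgM; [exact: cvg_cst|exact: cvg_id].
  exact: continuous_cos.
rewrite integral_itv_bndo_bndc; last first.
  apply/measurable_EFinP; apply: measurable_funTS.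
  exact: continuous_measurable_fun.
pose F (y : R) := w^-1 * sin (w * y + t).
have DF (y : R) : is_derive y 1 F (cos (w * y + t)).
  have D1 : is_derive y 1 (fun y : R => w * y + t) w.
    apply: (is_derive_eq (is_deriveD
      (is_deriveM (is_derive_cst w y 1) (is_derive_id y 1)) (is_derive_cst t y 1))).
    by rewrite /GRing.scale /=; ring.
  have D2 := @is_derive1_comp _ sin (fun y => w * y + t) _ _ _ (is_derive_sin _) D1.
  apply: (is_derive_eq (is_deriveM (is_derive_cst w^-1 y 1) D2)).
  by rewrite /GRing.scale /= mulr0 addr0 mulrCA mulVf ?mulr1.
have cF : continuous F.
  by move=> y; apply: differentiable_continuous; apply/derivable1_diffP; case: (DF y).
rewrite (@continuous_FTC2 _ _ F) //.
- by rewrite /F mulr1 mulr0 add0r (addrC w t) sinD_2pi_int -EFinB subrr.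
- exact: continuous_subspaceT.
- split; first by move=> y _; case: (DF y).
  + by apply: cvg_at_right_filter; exact: cF.
  + by apply: cvg_at_left_filter; exact: cF.
- by move=> y _; rewrite derive1E; apply: derive_val.
Qed.

Definition wave a b x : R := cos (2 * pi * (a%:~R * x.1 + b%:~R * x.2)).

Lemma waveM a b c d x :
  wave a b x * wave c d x =
  2^-1 * wave (a + c) (b + d) x + 2^-1 * wave (a - c) (b - d) x.
Proof.
rewrite /wave.
set s := 2 * pi * (a%:~R * _ + _); set t := 2 * pi * (c%:~R * _ + _).
have -> : 2 * pi * ((a + c)%:~R * x.1 + (b + d)%:~R * x.2) = s + t.
  by rewrite /s /t !intrD; ring.
have -> : 2 * pi * ((a - c)%:~R * x.1 + (b - d)%:~R * x.2) = s - t.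
  by rewrite /s /t !intrB; ring.
by rewrite cosD cosB; field.
Qed.

Lemma wave00 x : wave 0 0 x = 1.
Proof. by rewrite /wave !mul0r addr0 mulr0 cos0. Qed.

Lemma measurable_unit_square : measurable sq.
Proof. by apply: measurableX; exact: measurable_itv. Qed.

Lemma measure_unit_square : P sq = 1%E.
Proof.
have l1 : lebesgue_measure `[0%R, 1%R[ = 1%E :> \bar R.
  by rewrite lebesgue_measure_itv /= lte_fin ltr01 sube0.
rewrite product_measure1E; [by rewrite [X in (X * _)%E]l1 [X in (_ * X)%E]l1 mule1| |];
  exact: measurable_itv.
Qed.

Lemma measurable_wave a b : measurable_fun setT (wave a b).
Proof.
apply: (measurableT_comp (continuous_measurable_fun (@continuous_cos R))).
apply: measurable_funM => //; apply: measurable_funD; apply: measurable_funM => //.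
Qed.

Lemma integrable_bounded_unit_square (F : R * R -> R) (c : R) :
  measurable_fun setT F -> (forall x, `|F x| <= c) ->
  P.-integrable sq (EFin \o F).
Proof.
move=> mF Fc; apply: measurable_bounded_integrable.
- exact: measurable_unit_square.
- by rewrite [ltLHS]measure_unit_square ltry.
- exact: measurable_funTS.
- exists c; split; first exact: num_real.
  by move=> y cy x _ /=; rewrite (le_trans (Fc x)) ?ltW.
Qed.

Lemma integrable_wave a b : P.-integrable sq (EFin \o wave a b).
Proof.
apply: (@integrable_bounded_unit_square _ 1); first exact: measurable_wave.
by move=> x; rewrite ler_norml cos_geN1 cos_le1.
Qed.

Lemma integral_wave a b :
  (\int[P]_(x in sq) (wave a b x)%:E = ((a == 0) && (b == 0))%:R%:E)%E.
Proof.
have msq := measurable_unit_square.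
have iw : P.-integrable setT ((EFin \o wave a b) \_ sq).
  apply/integrable_restrict => //; rewrite setTI; exact: integrable_wave.
have sqE (y z : R) : (y, z) \in sq = (y \in `[0, 1[%R) && (z \in `[0, 1[%R).
  apply/idP/idP => [/set_mem[/= yI zI]|/andP[yI zI]].
    by rewrite yI zI.
  exact/mem_set.
(* A nonzero frequency is integrated over its own variable first, over whole
   periods. *)
have [a0|a0] := eqVneq a 0; last first.
  rewrite /= integral_mkcond -integral21_prod_meas1 //.
  apply: integral0_eq => y _; rewrite /fubini_G.
  have [yI|yI] := boolP (y \in `[0, 1[%R).
    rewrite -(integral_cos_period (2 * pi * (b%:~R * y)) a0) [RHS]integral_mkcond.
    apply: eq_integral => x _; rewrite !patchE sqE yI andbT mem_setE.
    by congr (if _ then (EFin (cos _)) else _) => /=; ring.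
  by apply: integral0_eq => x _; rewrite patchE sqE (negbTE yI) andbF.
have [b0|b0] := eqVneq b 0; last first.
  rewrite /= integral_mkcond -integral12_prod_meas1 //.
  apply: integral0_eq => y _; rewrite /fubini_F.
  have [yI|yI] := boolP (y \in `[0, 1[%R).
    rewrite -(integral_cos_period (2 * pi * (a%:~R * y)) b0) [RHS]integral_mkcond.
    apply: eq_integral => x _; rewrite !patchE sqE yI mem_setE.
    by congr (if _ then (EFin (cos _)) else _) => /=; ring.
  by apply: integral0_eq => x _; rewrite patchE sqE (negbTE yI).
rewrite a0 b0 (eq_integral (cst 1%E)) => [|x _]; last by rewrite wave00.
by rewrite integral_cst // [X in (_ * X)%E]measure_unit_square mule1.
Qed.

(** The expectation on the probability space of the matrix entries. *)
Definition mean (F : R * R -> R) : R := (\int[P]_(x in sq) F x)%R.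

Lemma mean_wave a b : mean (wave a b) = ((a == 0) && (b == 0))%:R.
Proof. by rewrite /mean /Rintegral integral_wave. Qed.

(** Nonnegative combinations of waves whose first frequency lies in S.  The
    second frequency is recorded only in the witness: a nonzero first frequency
    is enough for a wave to have mean zero. *)
Definition trig_cone (S : set int) (F : R * R -> R) :=
  exists s : seq (R * (int * int)),
    (forall u, u \in s -> 0 <= u.1 /\ S u.2.1) /\
    F = (fun x => \sum_(u <- s) u.1 * wave u.2.1 u.2.2 x).

Implicit Types (S T : set int) (F G : R * R -> R).

Lemma trig_cone_wave S a b : S a -> trig_cone S (wave a b).
Proof.
move=> Sa; exists [:: (1, (a, b))]; split.
  by move=> u; rewrite inE => /eqP ->; split => //=.
by apply/funext => x; rewrite big_seq1 mul1r.
Qed.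

Lemma trig_coneD S F G :
  trig_cone S F -> trig_cone S G -> trig_cone S (fun x => F x + G x).
Proof.
move=> [s [sP ->]] [t [tP ->]]; exists (s ++ t); split.
  by move=> u; rewrite mem_cat => /orP[/sP|/tP].
by apply/funext => x; rewrite big_cat.
Qed.

Lemma trig_coneZ S (c : R) F :
  0 <= c -> trig_cone S F -> trig_cone S (fun x => c * F x).
Proof.
move=> c0 [s [sP ->]]; exists [seq (c * u.1, u.2) | u <- s]; split.
  by move=> _ /mapP[u /sP[u0 Su] ->]; split => //=; rewrite mulr_ge0.
by apply/funext => x; rewrite big_map mulr_sumr; apply: eq_bigr => u _; rewrite mulrA.
Qed.

Lemma trig_cone0 S : trig_cone S (fun=> 0).
Proof. by exists [::]; split => //; apply/funext => x; rewrite big_nil. Qed.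

Lemma trig_cone_cst (c : R) : 0 <= c -> trig_cone setT (fun=> c).
Proof.
move=> c0; rewrite (_ : (fun=> c) = fun x => c * wave 0 0 x).
  by apply: trig_coneZ => //; exact: trig_cone_wave.
by apply/funext => x; rewrite wave00 mulr1.
Qed.

Lemma trig_cone_sum S (I : Type) (r : seq I) (F : I -> R * R -> R) :
  (forall i, trig_cone S (F i)) -> trig_cone S (fun x => \sum_(i <- r) F i x).
Proof.
move=> FP; elim: r => [|i r IH].
  by under eq_fun do rewrite big_nil; exact: trig_cone0.
by under eq_fun do rewrite big_cons; exact: trig_coneD.
Qed.

(** Frequencies of a product of two cosines. *)
Definition freq_mul S T : set int :=
  [set n | exists a b, [/\ S a, T b & n = a + b \/ n = a - b]].

(** Nonnegativity of the coefficients survives because a product of two cosines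
    is half the sum of the cosines of the sum and of the difference. *)
Lemma trig_coneM S T F G : trig_cone S F -> trig_cone T G ->
  trig_cone (freq_mul S T) (fun x => F x * G x).
Proof.
move=> [s [sP ->]] [t [tP ->]].
exists (flatten [seq [:: (u.1 * v.1 / 2, (u.2.1 + v.2.1, u.2.2 + v.2.2));
                         (u.1 * v.1 / 2, (u.2.1 - v.2.1, u.2.2 - v.2.2))]
                | u <- s, v <- t]); split.
  move=> w /flattenP[_ /allpairsP[[u v] [/sP[u0 Su] /tP[v0 Tv] ->]]].
  rewrite !inE => /orP[] /eqP -> /=; split; try by rewrite divr_ge0 ?mulr_ge0.
    by exists u.2.1, v.2.1; split => //; left.
  by exists u.2.1, v.2.1; split => //; right.
apply/funext => x; rewrite mulr_suml big_flatten /= big_allpairs_dep /=.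
apply: eq_bigr => u _; rewrite mulr_sumr; apply: eq_bigr => v _.
rewrite big_cons big_seq1 /= mulrACA waveM; ring.
Qed.

Lemma trig_coneS S T F : S `<=` T -> trig_cone S F -> trig_cone T F.
Proof.
move=> ST [s [sP ->]]; exists s; split => // u /sP[u0 Su].
by split => //; exact: ST.
Qed.

Lemma trig_coneMT F G : trig_cone setT F -> trig_cone setT G ->
  trig_cone setT (fun x => F x * G x).
Proof. by move=> FP GP; apply: trig_coneS (trig_coneM FP GP). Qed.

Lemma integrable_waves (s : seq (R * (int * int))) :
  P.-integrable sq (EFin \o fun x => \sum_(u <- s) u.1 * wave u.2.1 u.2.2 x).
Proof.
rewrite (_ : EFin \o _ = fun x => (\sum_(u <- s) (u.1%:E * (wave u.2.1 u.2.2 x)%:E))%E).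
  apply: integrable_sum; first exact: measurable_unit_square.
  move=> u _; apply: integrableZl; first exact: measurable_unit_square.
  exact: integrable_wave.
by apply/funext => x /=; rewrite -sumEFin.
Qed.

Lemma integrable_trig_cone S F : trig_cone S F -> P.-integrable sq (EFin \o F).
Proof. by move=> [s [_ ->]]; exact: integrable_waves. Qed.

Lemma meanD F G : P.-integrable sq (EFin \o F) -> P.-integrable sq (EFin \o G) ->
  mean (fun x => F x + G x) = mean F + mean G.
Proof. by move=> iF iG; apply: RintegralD => //; exact: measurable_unit_square. Qed.

Lemma meanZ (c : R) F : P.-integrable sq (EFin \o F) ->
  mean (fun x => c * F x) = c * mean F.
Proof. by move=> iF; apply: RintegralZl => //; exact: measurable_unit_square. Qed.

Lemma mean_cst (c : R) : mean (fun=> c) = c.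
Proof.
rewrite /mean Rintegral_cst; last exact: measurable_unit_square.
by rewrite [X in fine X]measure_unit_square mulr1.
Qed.

Lemma mean_sum (S : set int) (I : Type) (r : seq I) (F : I -> R * R -> R) :
  (forall i, trig_cone S (F i)) ->
  mean (fun x => \sum_(i <- r) F i x) = \sum_(i <- r) mean (F i).
Proof.
move=> FP; elim: r => [|i r IH].
  by under eq_fun do rewrite big_nil; rewrite mean_cst big_nil.
under eq_fun do rewrite big_cons; rewrite big_cons -IH meanD //.
  exact: integrable_trig_cone (FP i).
by apply: integrable_trig_cone; exact: (trig_cone_sum r FP).
Qed.

Lemma mean_trig_coneE (s : seq (R * (int * int))) :
  mean (fun x => \sum_(u <- s) u.1 * wave u.2.1 u.2.2 x) =
  \sum_(u <- s) u.1 * ((u.2.1 == 0) && (u.2.2 == 0))%:R.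
Proof.
elim: s => [|u s IH].
  by under eq_fun do rewrite big_nil; rewrite mean_cst big_nil.
under eq_fun do rewrite big_cons; rewrite big_cons -IH meanD; last 2 first.
- by have := integrable_waves [:: u]; under eq_fun do rewrite big_seq1.
- exact: integrable_waves.
by rewrite meanZ ?mean_wave //; exact: integrable_wave.
Qed.

Lemma mean_trig_cone_ge0 S F : trig_cone S F -> 0 <= mean F.
Proof.
move=> [s [sP ->]]; rewrite mean_trig_coneE big_seq; apply: sumr_ge0 => u /sP[u0 _].
by rewrite mulr_ge0.
Qed.

Lemma mean_trig_cone_eq0 S F : ~ S 0 -> trig_cone S F -> mean F = 0.
Proof.
move=> S0 [s [sP ->]]; rewrite mean_trig_coneE big_seq big1 // => u /sP[_ Su].
by case: eqP => [u0|]; [rewrite u0 in Su|rewrite mulr0].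
Qed.

End TrigonometricPolynomials.

(** * Products of entries as trigonometric polynomials *)

Section Moments.
Local Open Scope classical_set_scope.
Context {R : realType}.
Local Notation P := (lebesgue_measure \x lebesgue_measure)%E.
Local Notation sq := (@unit_square R).
Implicit Types (a b : int) (x : R * R) (F G : R * R -> R).

Definition two_waves a b x : R :=
  (Num.sqrt 2)^-1 * (wave a b x + wave (2 * a) (2 * b) x).

Lemma f_two_waves n m x :
  f ((M1 n)%:R * x.1) ((M2 m)%:R * x.2) = two_waves (2 ^+ n) (2 ^+ m) x.
Proof.
rewrite /f /two_waves /wave /M1 /M2 !natrX.
congr (_ * (cos _ + cos _)); rewrite ?rmorphM ?rmorphXn /=; ring.
Qed.

Lemma invsqrt2_ge0 : 0 <= (Num.sqrt 2)^-1 :> R.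
Proof. by rewrite invr_ge0 sqrtr_ge0. Qed.

Lemma invsqrt2_sqr : (Num.sqrt 2)^-1 ^+ 2 = 2^-1 :> R.
Proof. by rewrite exprVn sqr_sqrtr. Qed.

Lemma two_wavesM a b c d x : two_waves a b x * two_waves c d x =
  2^-1 * ((wave a b x + wave (2 * a) (2 * b) x) *
          (wave c d x + wave (2 * c) (2 * d) x)).
Proof. by rewrite -invsqrt2_sqr /two_waves; ring. Qed.

Lemma trig_cone_two_waves a b :
  trig_cone [set n | n = a \/ n = 2 * a] (two_waves a b).
Proof.
apply: trig_coneZ; first exact: invsqrt2_ge0.
by apply: trig_coneD; apply: trig_cone_wave; [left|right].
Qed.

Lemma wave_sqr a b x : wave a b x * wave a b x = 2^-1 + 2^-1 * wave (2 * a) (2 * b) x.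
Proof. by rewrite waveM !subrr wave00 mulr1 addrC -!mulr2n !mulr_natl. Qed.

(** The squares of the two waves contribute 1/4 each to the constant term; the
    waves left over have first frequencies 2a, 4a, 3a and - a. *)
Lemma two_waves_sqr a b : a != 0 -> exists2 G,
  trig_cone [set n | n != 0] G &
  forall x, two_waves a b x * two_waves a b x = 2^-1 + G x.
Proof.
move=> a0.
exists (fun x => 4^-1 * wave (2 * a) (2 * b) x +
  (4^-1 * wave (2 * (2 * a)) (2 * (2 * b)) x +
   (2^-1 * wave (a + 2 * a) (b + 2 * b) x + 2^-1 * wave (a - 2 * a) (b - 2 * b) x))).
  do 3?[apply: trig_coneD]; apply: trig_coneZ => //; apply: trig_cone_wave => /=; lia.
move=> x; rewrite two_wavesM.
have -> : forall u v : R, 2^-1 * ((u + v) * (u + v)) =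
    2^-1 * (u * u) + 2^-1 * (v * v) + u * v by move=> u v; field.
by rewrite !wave_sqr waveM; field.
Qed.

Lemma mean_two_waves_sqr a b : a != 0 ->
  mean (fun x => two_waves a b x * two_waves a b x) = 2^-1.
Proof.
move=> a0; have [G GP E] := two_waves_sqr b a0.
rewrite (_ : (fun x => _) = (fun x => 2^-1 + G x)); last exact/funext.
rewrite meanD.
- by rewrite mean_cst (mean_trig_cone_eq0 _ GP) ?addr0 //= => /eqP.
- exact: integrable_trig_cone (trig_cone_cst _).
- exact: integrable_trig_cone GP.
Qed.

(** F dominates c when F - c has nonnegative Fourier coefficients; unlike a
    bound on the mean, this is compatible with products. *)
Definition dominates (c : R) F := trig_cone setT (fun x => F x - c).

Lemma dominates_mean c F : dominates c F -> c <= mean F.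
Proof.
move=> D; rewrite (_ : F = fun x => (F x - c) + c); last first.
  by apply/funext => x; rewrite subrK.
rewrite meanD ?mean_cst; last 2 first.
- exact: integrable_trig_cone D.
- apply: (@integrable_bounded_unit_square _ _ `|c|) => //.
by rewrite lerDr (mean_trig_cone_ge0 D).
Qed.

Lemma dominatesM c d F G : 0 <= c -> 0 <= d ->
  dominates c F -> dominates d G -> dominates (c * d) (fun x => F x * G x).
Proof.
move=> c0 d0 DF DG; rewrite /dominates.
rewrite (_ : (fun x => _) = fun x => (F x - c) * (G x - d) +
    (c * (G x - d) + d * (F x - c))); last by apply/funext => x; ring.
apply: trig_coneD; first exact: trig_coneMT.
by apply: trig_coneD; exact: trig_coneZ.
Qed.

Lemma dominates_sum (I : Type) (r : seq I) (c : I -> R) (F : I -> R * R -> R) :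
  (forall i, dominates (c i) (F i)) ->
  dominates (\sum_(i <- r) c i) (fun x => \sum_(i <- r) F i x).
Proof.
move=> D; rewrite /dominates; under eq_fun do rewrite -sumrB.
exact: (trig_cone_sum r D).
Qed.

Lemma dominates_two_waves a b : dominates 0 (two_waves a b).
Proof.
rewrite /dominates; under eq_fun do rewrite subr0.
exact: trig_coneS (trig_cone_two_waves a b).
Qed.

Lemma dominates_two_waves_sqr a b : a != 0 ->
  dominates 2^-1 (fun x => two_waves a b x * two_waves a b x).
Proof.
move=> a0; have [G GP E] := two_waves_sqr b a0; rewrite /dominates.
under eq_fun do rewrite E addrAC subrr add0r.
exact: trig_coneS GP.
Qed.

(** The two factors share the wave of frequency (2a, 2b), whose square
    contributes a quarter to the constant term. *)
Lemma dominates_two_waves_double a b :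
  dominates 4^-1 (fun x => two_waves a b x * two_waves (2 * a) (2 * b) x).
Proof.
rewrite /dominates; pose w1 : R * R -> R := wave a b.
pose w2 : R * R -> R := wave (2 * a) (2 * b).
pose w4 : R * R -> R := wave (2 * (2 * a)) (2 * (2 * b)).
rewrite (_ : (fun x => _) = fun x => 2^-1 * (w1 x * w2 x) + (2^-1 * (w1 x * w4 x) +
    (2^-1 * (w2 x * w4 x) + 4^-1 * w4 x))); last first.
  apply/funext => x; rewrite two_wavesM -/w1 -/w2 -/w4.
  have -> : 4^-1 * w4 x = 2^-1 * (w2 x * w2 x) - 4^-1.
    by rewrite wave_sqr -/w4; field.
  by ring.
by do 3?[apply: trig_coneD]; apply: trig_coneZ => //; try apply: trig_coneMT;
  apply: trig_cone_wave.
Qed.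

Lemma two_waves_le2 a b x : `|two_waves a b x| <= 2.
Proof.
have c1 (t : R) : `|cos t| <= 1 by rewrite ler_norml cos_geN1 cos_le1.
rewrite normrM ger0_norm ?invsqrt2_ge0 // -[leRHS]mul1r.
have s1 : (Num.sqrt 2)^-1 <= 1 :> R.
  by rewrite invf_le1 ?sqrtr_gt0 // -[leLHS]sqrtr1 ler_wsqrtr // ler1n.
apply: (ler_pM invsqrt2_ge0 _ s1) => //.
by rewrite (le_trans (ler_normD _ _)) // (_ : 2 = 1 + 1) // lerD ?c1.
Qed.

End Moments.

(** * Second moment, and lower bounds for walks of length four *)

Section MatrixMoments.
Local Open Scope classical_set_scope.
Context {R : realType}.
Local Notation P := (lebesgue_measure \x lebesgue_measure)%E.
Local Notation sq := (@unit_square R).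
Implicit Types (x : R * R) (F G : R * R -> R).

Definition entry N (i j : 'I_N) x : R :=
  two_waves (2 ^+ (i.+1 + j.+1)) (2 ^+ `|i.+1 - j.+1|%N) x.

Definition entry_mx N x : 'M[R]_N := \matrix_(i, j) entry i j x.

Lemma X_entry_mx N x : X N x = (Num.sqrt N%:R)^-1 *: entry_mx N x.
Proof. by apply/matrixP => i j; rewrite !mxE f_two_waves. Qed.

Lemma entryC N (i j : 'I_N) : entry i j = entry j i.
Proof. by apply/funext => x; rewrite /entry addnC distnC. Qed.

Lemma X_sym N x : (X N x)^T = X N x :> 'M[R]_N.
Proof. by apply/matrixP => i j; rewrite X_entry_mx !mxE entryC. Qed.

Lemma mxtraceX_exp N x k :
  \tr (X N x ^+ k.*2) = (N%:R^-1) ^+ k * \tr (entry_mx N x ^+ k.*2).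
Proof.
rewrite X_entry_mx.
have -> : forall m (c : R) (A : 'M[R]_N), (c *: A) ^+ m = c ^+ m *: A ^+ m.
  move=> m c A; elim: m => [|m IH]; first by rewrite !expr0 scale1r.
  by rewrite !exprS IH -!mulmxE -scalemxAl -scalemxAr scalerA.
rewrite mxtraceZ; congr (_ * _).
by rewrite -mul2n exprM [_ ^-1 ^+ 2]exprVn sqr_sqrtr.
Qed.

Lemma pow2_neq0 n : 2 ^+ n != 0 :> int.
Proof. by rewrite expf_neq0. Qed.

Lemma dominates_entry N (i j : 'I_N) : dominates 0 (entry i j).
Proof. exact: dominates_two_waves. Qed.

Lemma dominates_entry_sqr N (i j : 'I_N) :
  dominates 2^-1 (fun x => entry i j x * entry i j x).
Proof. exact/dominates_two_waves_sqr/pow2_neq0. Qed.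

(** Below the diagonal, moving one row down doubles both frequencies: the sum and
    the difference of the indices each increase by one. *)
Lemma dominates_entry_succ N (i k j : 'I_N) : k = i.+1 :> nat -> (j <= i)%N ->
  dominates 4^-1 (fun x => entry i j x * entry k j x).
Proof.
move=> ki ji.
have := @dominates_two_waves_double R (2 ^+ (i.+1 + j.+1)) (2 ^+ `|i.+1 - j.+1|%N).
by rewrite -!exprS /entry ki (_ : `|i.+2 - j.+1|%N = `|i.+1 - j.+1|.+1%N) //; lia.
Qed.

Lemma mean_mxtrace2 N : mean (fun x => \tr (entry_mx N x ^+ 2)) = N%:R ^+ 2 / 2.
Proof.
have c0 (i j : 'I_N) : trig_cone setT (fun x => entry i j x * entry j i x).
  by apply: trig_coneMT; apply: trig_coneS (trig_cone_two_waves _ _).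
transitivity (mean (fun x => \sum_(i < N) \sum_(j < N) entry i j x * entry j i x)).
  congr mean; apply/funext => x; rewrite mxtrace2E; apply: eq_bigr => i _.
  by apply: eq_bigr => j _; rewrite !mxE.
rewrite (mean_sum _ (fun i => trig_cone_sum _ (c0 i))).
under eq_bigr => i _ do rewrite (mean_sum _ (c0 i)).
under eq_bigr => i _ do under eq_bigr => j _ do
  rewrite (entryC j i) mean_two_waves_sqr ?pow2_neq0 //.
by rewrite !sumr_const card_ord -mulrnA -[LHS]mulr_natr natrM mulrC expr2.
Qed.

Definition walk4_bound N (i k j l : 'I_N) : R :=
  4^-1 * ((i == k) * (j != l))%:R + 4^-1 * ((i != k) * (j == l))%:R +
  16^-1 * ((k == i.+1 :> nat) * ((j <= i) * (l <= i) * (j != l)))%N%:R.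

(** Three disjoint families of closed walks i - j - k - l - i carry the fourth
    moment: i = k, j = l, and k = i + 1 with j and l at most i.  The first two
    give the fourth moment of a semicircle; the last comes from the correlation
    of vertically adjacent entries. *)
Lemma dominates_walk4 N (i k j l : 'I_N) : dominates (walk4_bound i k j l)
  (fun x => entry i j x * entry j k x * (entry k l x * entry l i x)).
Proof.
have mulC F G : (fun x => F x * G x) = (fun x => G x * F x).
  by apply/funext => x; rewrite mulrC.
have all0 : dominates 0
    (fun x => entry i j x * entry j k x * (entry k l x * entry l i x)).
  rewrite -[0](mulr0 0); apply: dominatesM => //;
    by rewrite -[0](mulr0 0); apply: dominatesM => //; exact: dominates_entry.
rewrite /walk4_bound.
(* The families are disjoint, so at most one term of the bound is nonzero. *)
have [ik|ik] := eqVneq i k.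
  have [jl|jl] := eqVneq j l.
    by rewrite !(muln0, mul0n, mulr0, addr0) /=.
  rewrite -ik (_ : (i == i.+1 :> nat) = false); last by apply/negbTE; lia.
  rewrite !(muln0, mul0n, mulr0, addr0) /= mulr1.
  rewrite (entryC j i) (entryC l i) (_ : 4^-1 = 2^-1 * 2^-1); last by field.
  by apply: dominatesM => //; exact: dominates_entry_sqr.
have [jl|jl] := eqVneq j l.
  rewrite !(muln0, mul0n, mulr0, addr0, add0r) /= mulr1 -jl.
  rewrite (_ : (fun x => _) =
      (fun x => (entry i j x * entry i j x) * (entry j k x * entry j k x))).
    rewrite (_ : 4^-1 = 2^-1 * 2^-1); last by field.
    by apply: dominatesM => //; exact: dominates_entry_sqr.
  by apply/funext => x; rewrite (entryC k j) (entryC j i); ring.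
rewrite !(mul0n, mulr0, add0r) /=.
have [ki|_] := eqVneq (k : nat) i.+1; last by rewrite mul0n mulr0.
have [ji|_] := leqP j i; last by rewrite !(mul0n, muln0) mulr0.
have [li|_] := leqP l i; last by rewrite !(mul0n, muln0) mulr0.
rewrite !mul1n mulr1 (_ : 16^-1 = 4^-1 * 4^-1); last by field.
apply: dominatesM => //.
  by rewrite (entryC j k); exact: dominates_entry_succ.
by rewrite mulC (entryC l i); exact: dominates_entry_succ.
Qed.

End MatrixMoments.

(** * Fourth moment *)

Section FourthMoment.
Local Open Scope nat_scope.

Lemma sum_nat_of_pred (T : finType) (A : pred T) : \sum_(i : T) A i = #|A|.
Proof.
by rewrite -sum1_card [RHS]big_mkcond; apply: eq_bigr => i _; rewrite unfold_in; case: (A i).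
Qed.

Lemma sum_ord_eq N (i : 'I_N) : \sum_(k < N) (i == k) = 1.
Proof.
by rewrite sum_nat_of_pred -(card1 i); apply: eq_card => k; rewrite !inE eq_sym.
Qed.

Lemma sum_ord_neq N (i : 'I_N) : \sum_(k < N) (i != k) = N.-1.
Proof.
rewrite sum_nat_of_pred (_ : N.-1 = #|predC1 i|); last by rewrite cardC1 card_ord.
by apply: eq_card => k; rewrite !inE eq_sym.
Qed.

Lemma sum_ord_succ N (i : 'I_N) : \sum_(k < N) (k == i.+1 :> nat) = (i.+1 < N).
Proof.
have [iN|iN] := ltnP i.+1 N.
  apply: etrans (sum_ord_eq (Ordinal iN)).
  by apply: eq_bigr => k _; rewrite -val_eqE eq_sym.
rewrite big1 // => k _; apply/eqP; rewrite eqb0 neq_ltn.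
by rewrite (leq_trans (ltn_ord k) iN).
Qed.

Lemma sum_ord_le N (i : 'I_N) : \sum_(l < N) (l <= i) = i.+1.
Proof.
have <- : \sum_(l < i.+1) 1 = i.+1 by rewrite big_const_ord iter_addn mul1n addn0.
rewrite (big_ord_widen N (fun=> 1) (ltn_ord i)) [RHS]big_mkcond.
by apply: eq_bigr => l _; rewrite ltnS; case: leqP.
Qed.

Lemma sum_ord_le_neq N (i j : 'I_N) : j <= i ->
  \sum_(l < N) (l <= i) * (j != l) = i.
Proof.
move=> ji; apply: (@addnI 1); rewrite [RHS]add1n -[RHS](sum_ord_le i).
rewrite [RHS](bigD1 j) //= ji [X in _ + X = _](bigD1 j) //= eqxx muln0 add0n.
by congr (_ + _); apply: eq_bigr => l lj; rewrite eq_sym lj muln1.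
Qed.

Lemma sum_succ_mul n : 3 * \sum_(i < n) i.+1 * i = n.-1 * n * n.+1.
Proof.
elim: n => [|n IH]; first by rewrite big_ord0.
by rewrite big_ord_recr /= mulnDr IH; case: n {IH} => //= n; ring.
Qed.

(** The bound of a walk multiplied by 16, as an integer, so that the families of
    walks can be counted. *)
Definition walk4_count N (i k j l : 'I_N) :=
  4 * ((i == k) * (j != l)) + 4 * ((i != k) * (j == l)) +
  (k == i.+1 :> nat) * ((j <= i) * ((l <= i) * (j != l))).

Lemma sum_walk4_count N :
  3 * (\sum_(i < N) \sum_(k < N) \sum_(j < N) \sum_(l < N) walk4_count i k j l) =
  24 * (N * N * N.-1) + N.-2 * N.-1 * N.
Proof.
have D : \sum_(j < N) \sum_(l < N) (j != l) = N * N.-1.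
  by under eq_bigr do rewrite sum_ord_neq; rewrite sum_nat_const card_ord.
have D' : \sum_(j < N) \sum_(l < N) (j == l) = N.
  by under eq_bigr do rewrite sum_ord_eq; rewrite sum_nat_const card_ord muln1.
have T (i : 'I_N) : \sum_(j < N) \sum_(l < N) (j <= i) * ((l <= i) * (j != l)) = i.+1 * i.
  rewrite -[in RHS](sum_ord_le i) big_distrl /=; apply: eq_bigr => j _.
  by rewrite -big_distrr /=; have [/sum_ord_le_neq->|_] := leqP j i; rewrite ?mul0n.
have pull c (F : 'I_N -> 'I_N -> nat) :
    \sum_(j < N) \sum_(l < N) c * F j l = c * \sum_(j < N) \sum_(l < N) F j l.
  by rewrite big_distrr; apply: eq_bigr => j _; rewrite big_distrr.
have IK (i k : 'I_N) : \sum_(j < N) \sum_(l < N) walk4_count i k j l =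
    4 * (N * N.-1) * (i == k) + 4 * N * (i != k) + i.+1 * i * (k == i.+1 :> nat).
  rewrite /walk4_count; under eq_bigr => j _ do rewrite 2!big_split /=.
  rewrite 2!big_split /= !pull.
  by rewrite D D' T; ring.
under eq_bigr => i _.
  under eq_bigr => k _ do rewrite IK.
  rewrite 2!big_split -!big_distrr /= sum_ord_eq sum_ord_neq sum_ord_succ.
  over.
rewrite 2!big_split /= !sum_nat_const card_ord /=.
have -> : \sum_(i < N) i.+1 * i * (i.+1 < N) = \sum_(i < N.-1) i.+1 * i.
  case: N {D D' T pull IK} => [|n]; first by rewrite !big_ord0.
  rewrite big_ord_recr /= ltnn muln0 addn0; apply: eq_bigr => i _.
  by rewrite ltnS ltn_ord muln1.
by rewrite mulnDr sum_succ_mul; case: N {D D' T pull IK} => [|[|n]] //=; ring.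
Qed.

(** To leading order the fourth moment is at least N^3 (24 + 1) / 48, where a
    semicircle of the same variance has 24 / 48. *)
Lemma mean_mxtrace4_ge (R : realType) N :
  ((24 * (N * N * N.-1) + N.-2 * N.-1 * N)%:R <=
   48 * mean (fun x => \tr (entry_mx N x ^+ 4)) :> R)%R.
Proof.
rewrite (_ : (fun x => \tr _) = fun x : R * R => \sum_(i < N) \sum_(k < N) \sum_(j < N)
    \sum_(l < N) entry i j x * entry j k x * (entry k l x * entry l i x))%R; last first.
  apply/funext => x; rewrite mxtrace4E; do 4![apply: eq_bigr => ? _].
  by rewrite !mxE.
have /dominates_mean : dominates
    (\sum_(i < N) \sum_(k < N) \sum_(j < N) \sum_(l < N) (walk4_bound i k j l : R))%R
    (fun x => \sum_(i < N) \sum_(k < N) \sum_(j < N)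
      \sum_(l < N) entry i j x * entry j k x * (entry k l x * entry l i x))%R.
  do 4![apply: dominates_sum => ?]; exact: dominates_walk4.
rewrite -(@ler_pM2l _ 48) //; apply: le_trans.
rewrite -sum_walk4_count natrM (_ : 48 = 3 * 16)%R; last by ring.
rewrite -mulrA ler_pM2l // natr_sum mulr_sumr; apply: ler_sum => i _.
rewrite natr_sum mulr_sumr; apply: ler_sum => k _.
rewrite natr_sum mulr_sumr; apply: ler_sum => j _.
rewrite natr_sum mulr_sumr; apply: ler_sum => l _.
rewrite /walk4_count /walk4_bound !natrD !natrM.
by rewrite le_eqVlt; apply/orP; left; apply/eqP; field.
Qed.

End FourthMoment.

(** * Vanishing signed sums of powers of two *)

Section LacunarySums.

(** The smallest exponent of a vanishing signed sum of powers of two occurs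
    twice: otherwise the sum would be an odd multiple of the smallest power. *)
Lemma signed_pow2_sum0 (I : finType) (A : {set I}) (e : I -> bool) (t : I -> nat) :
  (0 < #|A|)%N -> \sum_(k in A) (-1) ^+ e k * 2 ^+ t k = 0 :> int ->
  exists k k', [/\ k \in A, k' \in A, k != k' & t k = t k'].
Proof.
move=> /card_gt0P[k0 k0A] S0.
have [k kA kmin] := arg_minnP t k0A.
have [/existsP[k' /and3P[k'A kk' /eqP tt]]|] :=
  boolP [exists k', [&& k' \in A, k != k' & t k == t k']].
  by exists k, k'.
rewrite negb_exists => /forallP Nk; exfalso.
have dvd_rest : (2 ^+ (t k).+1 %| \sum_(j in A | j != k) (-1) ^+ e j * 2 ^+ t j)%Z.
  apply: rpred_sum => j /andP[jA jk]; apply: dvdz_mull.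
  have kj : ((t k).+1 <= t j)%N.
    rewrite ltn_neqAle kmin // andbT.
    by have := Nk j; rewrite jA eq_sym jk.
  by rewrite -(subnK kj) exprD; apply: dvdz_mull.
have : (2 ^+ (t k).+1 %| (-1) ^+ e k * 2 ^+ t k)%Z.
  move: S0; rewrite (bigD1 k) //= => /eqP; rewrite addr_eq0 => /eqP ->.
  by rewrite rpredN.
rewrite !dvdzE abszM !abszX /= exp1n mul1n dvdn_Pexp2l // ltnn.
by [].
Qed.


(** Two equal smallest powers either cancel or merge into the next power of
    two; either way a second coincidence is forced among what is left. *)
Lemma signed_pow2_sum0_twice (I : finType) (e : I -> bool) (t : I -> nat) :
  (2 < #|I|)%N -> \sum_k (-1) ^+ e k * 2 ^+ t k = 0 :> int ->
  exists k k' l l', [/\ k != k', l != l', l != k & l != k'] /\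
    [/\ t k = t k', (t l <= (t l').+1)%N & (t l' <= (t l).+1)%N].
Proof.
move=> I3 S0.
have [||k [k' [_ _ kk' tk]]] := @signed_pow2_sum0 I [set: I]%SET e t.
- by rewrite cardsT (leq_trans _ I3).
- by rewrite -[RHS]S0; apply: eq_bigl => j; rewrite inE.
(* Opposite signs: the two equal terms cancel. *)
have [ek|ek] := eqVneq (e k) (e k'); last first.
  have [||l [l' [+ + ll' tl]]] := @signed_pow2_sum0 I (~: [set k; k']) e t.
  - by have := cardsC [set k; k']; rewrite cards2 kk' => E; rewrite -E in I3.
  - move: S0; rewrite (bigD1 k) //= (bigD1 k') 1?eq_sym //= tk addrA -mulrDl.
    have -> : (-1) ^+ e k + (-1) ^+ e k' = 0 :> int.
      by move: ek; case: (e k); case: (e k').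
    rewrite mul0r add0r => S0; rewrite -[RHS]S0; apply: eq_bigl => j.
    by rewrite !inE negb_or.
  rewrite !inE !negb_or => /andP[lk lk'] _.
  by exists k, k', l, l'; rewrite tl leqnSn.
(* Equal signs: the two equal terms are replaced by one at k with exponent
   t k + 1, and the index k' is dropped. *)
pose t' j := if j == k then (t k).+1 else t j.
have t't j : (t j <= t' j <= (t j).+1)%N.
  by rewrite /t'; case: eqP => [->|_]; rewrite ?leqnn leqnSn.
have [||l1 [l2 [+ + l12 tl]]] := @signed_pow2_sum0 I (~: [set k']) e t'.
- by have := cardsC [set k']; rewrite cards1 => E; rewrite -E in I3; apply: ltnW.
- move: S0; rewrite (bigD1 k) //= (bigD1 k') 1?eq_sym //= -tk -ek addrA -mulr2n.
  rewrite -mulrnAr -mulr_natl -exprS => S0; rewrite -[RHS]S0.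
  rewrite (bigD1 k) /=; last by rewrite !inE.
  rewrite {1}/t' eqxx; congr (_ + _).
  apply: eq_big => j; first by rewrite !inE andbC.
  by move=> /andP[_ jk]; rewrite /t' (negbTE jk).
rewrite !inE => l1k' l2k'.
have near a b : t' a = t' b -> (t a <= (t b).+1)%N.
  by move=> ab; have := t't a; have := t't b; rewrite ab; lia.
have [l1k|l1k] := eqVneq l1 k.
  exists k, k', l2, l1; split; split => //; rewrite ?near // 1?eq_sym //.
  by rewrite -l1k.
by exists k, k', l1, l2; split; split => //; rewrite near.
Qed.


Definition edge_sum N (i : {ffun 'I_6 -> 'I_N}) (k : 'I_6) : nat := i k + i (ordS k).

(** Coefficient of the vertex m in the sum of the end points of the edge k. *)
Definition edge_coef (k m : 'I_6) : int := (m == k)%:R + (m == ordS k)%:R.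

Lemma edge_sumE N (i : {ffun 'I_6 -> 'I_N}) k :
  (edge_sum i k)%:Z = \sum_m edge_coef k m * (i m)%:Z.
Proof.
rewrite /edge_sum PoszD; under eq_bigr do rewrite /edge_coef mulrDl.
have pick (a : 'I_6) : \sum_m (m == a)%:R * (i m)%:Z = (i a)%:Z.
  rewrite (bigD1 a) //= eqxx mul1r big1 ?addr0 // => m /negbTE ->.
  by rewrite mul0r.
by rewrite big_split /= !pick.
Qed.

Definition edge_minor (k k' l l' p q : 'I_6) : int :=
  (edge_coef k p - edge_coef k' p) * (edge_coef l q - edge_coef l' q) -
  (edge_coef k q - edge_coef k' q) * (edge_coef l p - edge_coef l' p).

(** The edge sums of a closed walk satisfy the single relation
    s0 - s1 + s2 - s3 + s4 - s5 = 0, which involves six edges; two differences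
    involve at most four, so they are independent.  The 6^4 cases are
    evaluated. *)
Lemma edge_minor_neq0 k k' l l' : k != k' -> l != l' -> l != k -> l != k' ->
  exists p q, p != q /\ edge_minor k k' l l' p q != 0.
Proof.
pose c (k m : nat) : int := (m == k)%:R + (m == (k.+1 %% 6)%N)%:R.
have cE (a b : 'I_6) : edge_coef a b = c a b by [].
pose ok (k k' l l' p q : nat) := (p != q) &&
  ((c k p - c k' p) * (c l q - c l' q) - (c k q - c k' q) * (c l p - c l' p) != 0).
have chk : all (fun k => all (fun k' => all (fun l => all (fun l' =>
    [&& k != k', l != l', l != k & l != k'] ==>
    has (fun p => has (ok k k' l l' p) (iota 0 6)) (iota 0 6))
  (iota 0 6)) (iota 0 6)) (iota 0 6)) (iota 0 6) by vm_compute.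
move=> kk' ll' lk lk'.
have io (a : 'I_6) : (a : nat) \in iota 0 6 by rewrite mem_iota /= ltn_ord.
move: chk => /allP/(_ _ (io k))/allP/(_ _ (io k'))/allP/(_ _ (io l)).
move=> /allP/(_ _ (io l'))/implyP; rewrite !val_eqE kk' ll' lk lk' => /(_ isT).
case/hasP => p; rewrite mem_iota => /andP[_ p6] /hasP[q].
rewrite mem_iota => /andP[_ q6] /andP[pq minor].
by exists (Ordinal p6), (Ordinal q6); split.
Qed.

(** The offset 2 on the left lets the errors, which range over -2, ..., 2, be
    recorded by natural numbers less than 5. *)
Definition edge_relation N (u : 'I_6 * 'I_6 * 'I_6 * 'I_6 * 'I_5 * 'I_5) :=
  let: (k, k', l, l', e1, e2) := u in
  [set i : {ffun 'I_6 -> 'I_N} |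
    [&& k != k', l != l', l != k & l != k'] &&
    ((edge_sum i k + 2 == edge_sum i k' + e1) &&
     (edge_sum i l + 2 == edge_sum i l' + e2))%N].

(** Two independent linear equations determine two of the vertices from the other
    four: erasing the coordinates of a nonzero minor is injective. *)
Lemma card_edge_relation N u : (#|edge_relation N u| <= N ^ 4)%N.
Proof.
case: u => [[[[[k k'] l] l'] e1] e2].
case: N => [|N].
  by rewrite leqn0 cards_eq0; apply/eqP/setP => i; case: (i ord0).
have [/and4P[kk' ll' lk lk']|] := boolP [&& k != k', l != l', l != k & l != k'];
  last first.
  move=> /negbTE E; rewrite (_ : edge_relation _ _ = finset.set0) ?cards0 //.
  by apply/setP => i; rewrite !inE E.
have [p [q [pq minor]]] := edge_minor_neq0 kk' ll' lk lk'.
pose erase (i : {ffun 'I_6 -> 'I_N.+1}) :=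
  [ffun m => if (m == p) || (m == q) then ord0 else i m].
have erase_inj : {in edge_relation N.+1 (k, k', l, l', e1, e2) &, injective erase}.
  move=> i j; rewrite !inE => /andP[_ /andP[/eqP i1 /eqP i2]].
  move=> /andP[_ /andP[/eqP j1 /eqP j2]] ij.
  have off m : m != p -> m != q -> i m = j m.
    move=> mp mq; have := congr1 (fun f : {ffun 'I_6 -> 'I_N.+1} => f m) ij.
    by rewrite !ffunE (negbTE mp) (negbTE mq).
  pose y (m : 'I_6) := (i m)%:Z - (j m)%:Z.
  have rel a b (e : nat) : (edge_sum i a + 2 = edge_sum i b + e)%N ->
      (edge_sum j a + 2 = edge_sum j b + e)%N ->
      (edge_coef a p - edge_coef b p) * y p +
      (edge_coef a q - edge_coef b q) * y q = 0.
    move=> ia ja.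
    have : \sum_m (edge_coef a m - edge_coef b m) * y m = 0.
      have dE (h : {ffun 'I_6 -> 'I_N.+1}) :
          (edge_sum h a)%:Z - (edge_sum h b)%:Z =
          \sum_m (edge_coef a m - edge_coef b m) * (h m)%:Z.
        by rewrite !edge_sumE -sumrB; apply: eq_bigr => m _; rewrite mulrBl.
      rewrite (eq_bigr _ (fun m _ => mulrBr _ _ _)) sumrB -!dE; lia.
    rewrite (bigD1 p) //= (bigD1 q) 1?eq_sym //= big1 ?addr0 // => m /andP[mp mq].
    by rewrite /y off // subrr mulr0.
  have r1 := rel _ _ _ i1 j1; have r2 := rel _ _ _ i2 j2.
  (* Cramer's rule. *)
  have cramer (a b c d x z : int) : a * x + b * z = 0 -> c * x + d * z = 0 ->
      (a * d - b * c) * x = 0 /\ (a * d - b * c) * z = 0.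
    move=> h1 h2; split.
      transitivity (d * (a * x + b * z) - b * (c * x + d * z)); first by ring.
      by rewrite h1 h2 !mulr0 subrr.
    transitivity (a * (c * x + d * z) - c * (a * x + b * z)); first by ring.
    by rewrite h1 h2 !mulr0 subrr.
  have [xp xq] := cramer _ _ _ _ _ _ r1 r2.
  have zero m : y m = 0 -> i m = j m.
    by move=> /eqP; rewrite subr_eq0 => /eqP[] /val_inj.
  apply/ffunP => m; have [->|mp] := eqVneq m p.
    by apply: zero; move/eqP: xp; rewrite mulf_eq0 (negbTE minor) => /eqP.
  have [->|mq] := eqVneq m q; last exact: off.
  by apply: zero; move/eqP: xq; rewrite mulf_eq0 (negbTE minor) => /eqP.
rewrite -(card_in_imset erase_inj).
have <- : #|pffun_on (ord0 : 'I_N.+1) (mem (~: [set p; q]))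
    (mem [set: 'I_N.+1]%SET)| = (N.+1 ^ 4)%N.
  rewrite card_pffun_on cardsT card_ord; congr (_ ^ _)%N.
  by transitivity #|~: [set p; q]|; rewrite // cardsCs finset.setCK cards2 pq card_ord.
apply: subset_leq_card; apply/fintype.subsetP => _ /imsetP[i _ ->].
apply/pffun_onP; split.
  apply/fintype.subsetP => m; rewrite !inE ffunE negb_or.
  by case: (m == p) => //=; case: (m == q).
by move=> *; rewrite inE.
Qed.

Definition near_closed_walk N (i : {ffun 'I_6 -> 'I_N}) :=
  [exists u, i \in edge_relation N u].

Lemma card_near_closed_walk N :
  (#|[set i : {ffun 'I_6 -> 'I_N} | near_closed_walk i]| <= 6 ^ 4 * 5 ^ 2 * N ^ 4)%N.
Proof.
apply: (@leq_trans (\sum_u #|edge_relation N u|)).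
  apply: (@leq_trans #|\bigcup_u edge_relation N u|).
    apply: subset_leq_card; apply/fintype.subsetP => i; rewrite inE => /existsP[u iu].
    by apply/finset.bigcupP; exists u.
  elim/big_rec2: _ => [|u m A _ IH]; first by rewrite cards0.
  by rewrite (leq_trans (leq_card_setU _ _)) // leq_add2l.
apply: (@leq_trans (\sum_(u : 'I_6 * 'I_6 * 'I_6 * 'I_6 * 'I_5 * 'I_5) N ^ 4)).
  by apply: leq_sum => u _; exact: card_edge_relation.
by rewrite sum_nat_const !card_prod !card_ord.
Qed.

(** Exponents exceed their edge sums by 2 or 3, so exponents that differ by at
    most 1 belong to edge sums that differ by at most 2. *)
Lemma near_closed_walkP N (i : {ffun 'I_6 -> 'I_N}) (e : 'I_6 -> bool)
    (t : 'I_6 -> nat) :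
  (forall k, edge_sum i k + 2 <= t k <= edge_sum i k + 3)%N ->
  \sum_k (-1) ^+ e k * 2 ^+ t k = 0 :> int -> near_closed_walk i.
Proof.
move=> ti /signed_pow2_sum0_twice[|k [k' [l [l' [[kk' ll' lk lk'] [tk tl tl']]]]]].
  by rewrite card_ord.
have [tik tik'] := (ti k, ti k'); have [til til'] := (ti l, ti l').
have e1 : (edge_sum i k + 2 - edge_sum i k' < 5)%N by lia.
have e2 : (edge_sum i l + 2 - edge_sum i l' < 5)%N by lia.
apply/existsP; exists (k, k', l, l', Ordinal e1, Ordinal e2).
by rewrite inE kk' ll' lk lk' /=; apply/andP; split; apply/eqP; lia.
Qed.

End LacunarySums.

(** * Sixth moment *)

Section SixthMoment.
Local Open Scope classical_set_scope.
Context {R : realType}.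
Local Notation P := (lebesgue_measure \x lebesgue_measure)%E.
Local Notation sq := (@unit_square R).
Implicit Types (x : R * R) (F G : R * R -> R).

(** The membership in the cone is carried along because it makes the mean of a
    sum the sum of the means. *)
Definition capped (c : R) F := trig_cone setT F /\ mean F <= c.

Lemma capped_sum (I : Type) (r : seq I) (c : I -> R) (F : I -> R * R -> R) :
  (forall i, capped (c i) (F i)) ->
  capped (\sum_(i <- r) c i) (fun x => \sum_(i <- r) F i x).
Proof.
move=> D; have FP i : trig_cone setT (F i) by case: (D i).
split; first exact: trig_cone_sum.
by rewrite (mean_sum _ FP); apply: ler_sum => i _; case: (D i).
Qed.

Definition closed_walk N (i0 i1 i2 i3 i4 i5 : 'I_N) : {ffun 'I_6 -> 'I_N} :=
  [ffun k : 'I_6 => nth i0 [:: i0; i1; i2; i3; i4; i5] k].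

Definition edge_freqs N (i j : 'I_N) : set int :=
  [set n | exists d : bool, n = 2 ^+ (d + (i.+1 + j.+1))].

Lemma trig_cone_entry N (i j : 'I_N) : trig_cone (edge_freqs i j) (@entry R N i j).
Proof.
apply: trig_coneS (trig_cone_two_waves _ _) => n /= [|] ->.
  by exists false.
by exists true; rewrite -exprS.
Qed.

Lemma freq_mulP (S T : set int) n : freq_mul S T n ->
  exists a b (e : bool), [/\ S a, T b & n = a + (-1) ^+ e * b].
Proof.
move=> [a [b [Sa Tb []]]] ->; exists a, b; [exists false|exists true]; split => //.
  by rewrite mul1r.
by rewrite mulN1r.
Qed.

(** A product of six entries has mean zero unless one of its first frequencies,
    signed sums of powers of two, vanishes; otherwise it is at most 2^6. *)
Lemma capped_walk6 N (i0 i1 i2 i3 i4 i5 : 'I_N) :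
  capped (64 * (near_closed_walk (closed_walk i0 i1 i2 i3 i4 i5))%:R)
    (fun x => entry i0 i1 x * entry i1 i2 x * entry i2 i3 x * entry i3 i4 x *
              entry i4 i5 x * entry i5 i0 x).
Proof.
have bounds (s : nat) (d : bool) : (s + 2 <= d + (s + 2) <= s + 3)%N.
  by case: d; lia.
have E (a b : nat) : (a + b + 2 = a.+1 + b.+1)%N by lia.
have W := trig_coneM (trig_coneM (trig_coneM (trig_coneM (trig_coneM
  (trig_cone_entry i0 i1) (trig_cone_entry i1 i2)) (trig_cone_entry i2 i3))
  (trig_cone_entry i3 i4)) (trig_cone_entry i4 i5)) (trig_cone_entry i5 i0).
split; first exact: trig_coneS W.
case: (boolP (near_closed_walk _)) => [_|far]; last first.
  rewrite mulr0 (mean_trig_cone_eq0 _ W) //.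
  move=> /freq_mulP[a [b [e5 [+ [d5 ->]]]]].
  move=> /freq_mulP[{}a [{}b [e4 [+ [d4 ->] ->]]]].
  move=> /freq_mulP[{}a [{}b [e3 [+ [d3 ->] ->]]]].
  move=> /freq_mulP[{}a [{}b [e2 [+ [d2 ->] ->]]]].
  move=> /freq_mulP[{}a [{}b [e1 [[d0 ->] [d1 ->] ->]]]] /esym S0.
  move/negP: far; apply.
  pose e (k : 'I_6) := nth false [:: false; e1; e2; e3; e4; e5] k.
  pose t (k : 'I_6) := (nth false [:: d0; d1; d2; d3; d4; d5] k +
    (edge_sum (closed_walk i0 i1 i2 i3 i4 i5) k + 2))%N.
  apply: (@near_closed_walkP _ _ e t) => [k|].
    exact: bounds.
  rewrite -[RHS]S0 !big_ord_recl big_ord0 /e /t /edge_sum /closed_walk !ffunE /=.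
  rewrite expr0 mul1r addr0 !addrA.
  by rewrite !E.
rewrite mulr1 -(mean_cst 64); apply: le_Rintegral.
- exact: measurable_unit_square.
- exact: integrable_trig_cone W.
- by apply: (@integrable_bounded_unit_square _ _ 64) => // x; rewrite ger0_norm.
- move=> x _; apply: (le_trans (ler_norm _)).
  rewrite (_ : 64 = 2 * 2 * 2 * 2 * 2 * 2); last by ring.
  have step (u v c : R) : `|u| <= c -> `|v| <= 2 -> `|u * v| <= c * 2.
    by move=> uc v2; rewrite normrM ler_pM.
  do 5![apply: (@step); last exact: two_waves_le2]; exact: two_waves_le2.
Qed.

Lemma closed_walk_inj N (i0 i1 i2 i3 i4 i5 j0 j1 j2 j3 j4 j5 : 'I_N) :
  closed_walk i0 i1 i2 i3 i4 i5 = closed_walk j0 j1 j2 j3 j4 j5 ->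
  [/\ i0 = j0, i1 = j1 & i2 = j2] /\ [/\ i3 = j3, i4 = j4 & i5 = j5].
Proof.
move=> E; have at_ k (k6 : (k < 6)%N) :=
  congr1 (fun f : {ffun 'I_6 -> 'I_N} => f (Ordinal k6)) E.
by do !split; [have := at_ 0%N isT|have := at_ 1%N isT|have := at_ 2%N isT
  |have := at_ 3%N isT|have := at_ 4%N isT|have := at_ 5%N isT]; rewrite !ffunE.
Qed.

(** Only the nearly resonant walks contribute, and they fill four of the six
    dimensions, so the normalised sixth moment is bounded. *)
Lemma mean_mxtrace6_le N :
  mean (fun x => \tr (entry_mx N x ^+ 6)) <= (64 * (6 ^ 4 * 5 ^ 2) * N ^ 4)%:R :> R.
Proof.
rewrite (_ : (fun x => \tr _) = fun x : R * R => \sum_(i0 < N) \sum_(i3 < N)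
   \sum_(i1 < N) \sum_(i2 < N) \sum_(i4 < N) \sum_(i5 < N)
     (entry i0 i1 x * entry i1 i2 x * entry i2 i3 x * entry i3 i4 x *
              entry i4 i5 x * entry i5 i0 x)); last first.
  apply/funext => x; rewrite mxtrace6E; do 6![apply: eq_bigr => ? _].
  by rewrite !mxE !mulrA.
have [_] : capped (\sum_(i0 < N) \sum_(i3 < N)
   \sum_(i1 < N) \sum_(i2 < N) \sum_(i4 < N) \sum_(i5 < N)
     64 * (near_closed_walk (closed_walk i0 i1 i2 i3 i4 i5))%:R)
  (fun x : R * R => \sum_(i0 < N) \sum_(i3 < N)
   \sum_(i1 < N) \sum_(i2 < N) \sum_(i4 < N) \sum_(i5 < N)
     (entry i0 i1 x * entry i1 i2 x * entry i2 i3 x * entry i3 i4 x *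
              entry i4 i5 x * entry i5 i0 x)).
  do 6![apply: capped_sum => ?]; exact: capped_walk6.
move=> /le_trans; apply; rewrite !pair_bigA /= -mulr_sumr -natr_sum -mulnA natrM.
rewrite ler_pM2l // ler_nat; apply: leq_trans (card_near_closed_walk N).
pose walk (p : 'I_N * 'I_N * 'I_N * 'I_N * 'I_N * 'I_N) :=
  let: (i0, i3, i1, i2, i4, i5) := p in closed_walk i0 i1 i2 i3 i4 i5.
have walk_inj : injective walk.
  move=> [[[[[i0 i3] i1] i2] i4] i5] [[[[[j0 j3] j1] j2] j4] j5].
  by move=> /closed_walk_inj[[-> -> ->] [-> -> ->]].
rewrite (eq_bigr (fun p => near_closed_walk (walk p) : nat)); last first.
  by move=> [[[[[i0 i3] i1] i2] i4] i5] _.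
rewrite -big_mkcond sum1dep_card -(card_imset _ walk_inj).
apply: subset_leq_card; apply/fintype.subsetP => _ /imsetP[p + ->].
by rewrite !inE.
Qed.

End SixthMoment.

(** * Comparison with the semicircle law *)

Section Comparison.
Local Open Scope classical_set_scope.
Context {R : realType}.
Local Notation P := (lebesgue_measure \x lebesgue_measure)%E.
Local Notation sq := (@unit_square R).
Implicit Types (x : R * R) (N k : nat).

Lemma trig_cone_mxtrace_exp N k :
  trig_cone setT (fun x : R * R => \tr (entry_mx N x ^+ k)).
Proof.
have EP (i j : 'I_N) : trig_cone setT (fun x : R * R => (entry_mx N x ^+ k) i j).
  elim: k i j => [|k IH] i j.
    rewrite (_ : (fun x => _) = fun=> (i == j)%:R); last first.
      by apply/funext => x; rewrite expr0 mxE.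
    exact: trig_cone_cst.
  rewrite (_ : (fun x => _) =
      fun x => \sum_l entry i l x * (entry_mx N x ^+ k) l j); last first.
    apply/funext => x; rewrite exprS -mulmxE mxE; apply: eq_bigr => l _.
    by rewrite !mxE.
  apply: trig_cone_sum => l; apply: trig_coneMT => //.
  exact: trig_coneS (trig_cone_entry i l).
exact: (trig_cone_sum _ (fun i => EP i i)).
Qed.

(** The moment of order 2k of the mean empirical distribution, expressed through
    traces. *)
Definition mean_moment N k : R := mean (fun x => N%:R^-1 * \tr (X N x ^+ k.*2)).

Lemma integrable_moment N k :
  P.-integrable sq (EFin \o (fun x : R * R => N%:R^-1 * \tr (X N x ^+ k.*2))).
Proof.
rewrite (_ : (fun x => _) = fun x : R * R =>
    N%:R^-1 ^+ k.+1 * \tr (entry_mx N x ^+ k.*2)); last first.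
  by apply/funext => x; rewrite mxtraceX_exp mulrA -exprS.
apply: (@integrable_trig_cone _ setT); apply: trig_coneZ.
  by rewrite exprn_ge0 // invr_ge0.
exact: trig_cone_mxtrace_exp.
Qed.

Lemma mean_momentE N k : mean_moment N k =
  N%:R^-1 ^+ k.+1 * mean (fun x : R * R => \tr (entry_mx N x ^+ k.*2)).
Proof.
rewrite -meanZ; last exact/integrable_trig_cone/trig_cone_mxtrace_exp.
by congr mean; apply/funext => x; rewrite mxtraceX_exp mulrA -exprS.
Qed.

Lemma mean_moment1 N : (0 < N)%N -> mean_moment N 1 = 2^-1.
Proof.
move=> N0; rewrite mean_momentE [mean _]mean_mxtrace2 exprVn.
by rewrite mulrA mulVf ?mul1r // expf_neq0 // pnatr_eq0 -lt0n.
Qed.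

Lemma mean_moment2_ge N : (100 <= N)%N -> 49 / 96 <= mean_moment N 2.
Proof.
move=> N100; rewrite mean_momentE exprVn [leRHS]mulrC ler_pdivlMr ?exprn_gt0 ?ltr0n //; last lia.
rewrite -(@ler_pM2l _ 96) //.
have -> : 96 * (49 / 96 * N%:R ^+ 3) = 49 * N%:R ^+ 3 :> R by field.
apply: (@le_trans _ _ (2 * (48 * mean (fun x : R * R => \tr (entry_mx N x ^+ 4))))); last first.
  by rewrite mulrA -natrM.
apply: (le_trans _ (ler_wpM2l (ler0n R 2) (mean_mxtrace4_ge R N))).
rewrite -natrX -!natrM ler_nat.
case: N N100 => [|[|n]] //= n98; rewrite !expnS expn0.
nia.
Qed.

Definition moment6_bound : R := 64 * (6 ^+ 4 * 5 ^+ 2).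

Lemma mean_moment3_le N : (0 < N)%N -> mean_moment N 3 <= moment6_bound.
Proof.
move=> N0; rewrite mean_momentE exprVn [leLHS]mulrC ler_pdivrMr ?exprn_gt0 ?ltr0n //.
by apply: (le_trans (mean_mxtrace6_le N)); rewrite !(natrX, natrM).
Qed.

(** An even polynomial majorant of a nonnegative test function bounds its
    integral against the mean empirical distribution; if the test function is
    polynomial on the support of the semicircle law, the limit is explicit. *)
Lemma semicircle_limit_le (r : R) (g : R -> R) (a b d a0 a1 a2 a3 B : R) (N0 : nat) :
  0 < r ->
  weakly_converges (fun N => mean_empirical_dist (@X R N)) (semicircle_law r) ->
  continuous g -> (exists M, forall y, `|g y| <= M) -> (forall y, 0 <= g y) ->
  (forall y, - r <= y <= r -> g y = a + b * y ^+ 2 + d * y ^+ 4) ->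
  (forall y, g y <= a0 + a1 * y ^+ 2 + a2 * y ^+ 4 + a3 * y ^+ 6) ->
  (forall N, (N0 < N)%N ->
     a0 + a1 * mean_moment N 1 + a2 * mean_moment N 2 + a3 * mean_moment N 3 <= B) ->
  a + b * (r ^+ 2 / 4) + d * (r ^+ 4 / 8) <= B.
Proof.
move=> r0 wc cg bg g0 gE gp pB.
rewrite -lee_fin -(integral_semicircle_moments r0).
have -> : (\int[lebesgue_measure]_(y in `[(- r)%R, r])
     ((a + b * y ^+ 2 + d * y ^+ 4) * semicircle_pdf r y)%:E =
   \int[lebesgue_measure]_(y in `[(- r)%R, r]) (g y * semicircle_pdf r y)%:E)%E.
  by apply: eq_integral => y /set_mem /=; rewrite in_itv /= => /gE ->.
apply: (le_trans (integral_semicircle_law_ge r g0 cg)).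
have cv := wc g cg bg.
rewrite -(cvg_lim _ cv) //; apply: lime_le; first by apply/cvg_ex; eexists; exact: cv.
exists N0.+1 => // N /= N0N.
(* The average of the majorant over the spectrum is a combination of traces. *)
pose G x := a0 + a1 * (N%:R^-1 * \tr (X N x ^+ 1.*2)) +
  a2 * (N%:R^-1 * \tr (X N x ^+ 2.*2)) + a3 * (N%:R^-1 * \tr (X N x ^+ 3.*2)).
have N_neq0 : N%:R != 0 :> R by rewrite pnatr_eq0; lia.
apply: (le_trans (@integral_mean_empirical_dist_le _ _ _ g G g0 _)).
  move=> x _.
  have -> : G x = N%:R^-1 * \sum_(l <- eigenvalues (X N x))
      (a0 + a1 * l ^+ 2 + a2 * l ^+ 4 + a3 * l ^+ 6).
    rewrite !big_split -!mulr_sumr /= !sum_eigenvalues_exp ?X_sym //.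
    have -> : \sum_(l <- eigenvalues (X N x)) a0 = a0 * N%:R.
      transitivity (a0 * \sum_(l <- eigenvalues (X N x)) l ^+ 0).
        by rewrite mulr_sumr; apply: eq_bigr => l _; rewrite expr0 mulr1.
      by rewrite sum_eigenvalues_exp ?X_sym // expr0 mxtrace1.
    by rewrite /G /=; field.
  rewrite ler_wpM2l ?invr_ge0 //; apply: ler_sum => l _; exact: gp.
have i0 : P.-integrable sq (EFin \o (fun=> a0)).
  by apply: (@integrable_bounded_unit_square _ _ `|a0|).
have iM c k : P.-integrable sq
    (EFin \o (fun x : R * R => c * (N%:R^-1 * \tr (X N x ^+ k.*2)))).
  rewrite (_ : EFin \o _ =
    fun x : R * R => (c%:E * (N%:R^-1 * \tr (X N x ^+ k.*2))%:E)%E) //.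
  apply: integrableZl; [exact: measurable_unit_square|exact: integrable_moment].
have iD (F H : R * R -> R) : P.-integrable sq (EFin \o F) ->
    P.-integrable sq (EFin \o H) -> P.-integrable sq (EFin \o (fun x => F x + H x)).
  move=> iF iH; rewrite (_ : EFin \o _ = ((EFin \o F) \+ (EFin \o H))%E) //.
  by apply: integrableD => //; exact: measurable_unit_square.
have i1 := iD _ _ i0 (iM a1 1%N); have i2 := iD _ _ i1 (iM a2 2%N).
have iG : P.-integrable sq (EFin \o G) := iD _ _ i2 (iM a3 3%N).
rewrite -[X in (X <= _)%E]fineK; last first.
  by apply: integrable_fin_num; [exact: measurable_unit_square|exact: iG].
rewrite lee_fin; apply: (@le_trans _ _ (mean G)); first exact: lexx.
have -> : mean G = a0 + a1 * mean_moment N 1 + a2 * mean_moment N 2 + a3 * mean_moment N 3.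
  rewrite /G (meanD i2 (iM a3 3%N)) (meanD i1 (iM a2 2%N)) (meanD i0 (iM a1 1%N)).
  by rewrite mean_cst (meanZ a1 (integrable_moment N 1)) (meanZ a2 (integrable_moment N 2))
    (meanZ a3 (integrable_moment N 3)).
exact: pB.
Qed.

End Comparison.

Theorem mainTheorem3 (R : realType) (r : R) (hr : 0 < r) :
  ~ weakly_converges (fun N => mean_empirical_dist (@X R N)) (semicircle_law r).
Proof.
move=> wc.
have cX n : continuous (fun y : R => y ^+ n) by exact: exprn_continuous.
(* The variance: min(y^2, r^2) is at most y^2, with equality on the support. *)
have r2 : 0 + 1 * (r ^+ 2 / 4) + 0 * (r ^+ 4 / 8) <= 2^-1.
  apply: (@semicircle_limit_le _ r (fun y => Num.min (y ^+ 2) (r ^+ 2))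
    0 1 0 0 1 0 0 2^-1 0 hr wc).
  - move=> y; apply: (@continuous_min _ _ (fun y : R => y ^+ 2) (fun=> r ^+ 2)).
      exact: cX.
    exact: cst_continuous.
  - exists (r ^+ 2) => y; rewrite ger0_norm ?ge_min ?lexx ?orbT //.
    by rewrite le_min !sqr_ge0.
  - by move=> y; rewrite le_min !sqr_ge0.
  - move=> y /andP[ry yr]; rewrite min_l; first by ring.
    nra.
  - move=> y; rewrite ge_min; apply/orP; left; rewrite le_eqVlt; apply/orP; left.
    by apply/eqP; ring.
  - by move=> N N0; rewrite mean_moment1 // !mul0r mul1r !addr0 add0r.
(* The truncation level L exceeds r, and the sixth moment divided by L^2 must be
   below the excess 49/96 - 1/2 = 1/96 of the fourth moment. *)
pose L := r + 10 ^+ 5.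
have rL : r <= L by rewrite lerDl.
have L2 : 10 ^+ 10 <= L ^+ 2.
  by rewrite (exprM _ 5 2) ler_pXn2r ?nnegrE //; rewrite /L; lra.
have L0 : 0 < L by rewrite (lt_le_trans hr).
(* The fourth moment: max(0, L^4 - y^4) equals L^4 - y^4 on the support and is
   at most L^4 - y^4 + y^6 / L^2 everywhere. *)
have r4 : L ^+ 4 + 0 * (r ^+ 2 / 4) + -1 * (r ^+ 4 / 8) <=
    L ^+ 4 - 49 / 96 + moment6_bound / L ^+ 2.
  apply: (@semicircle_limit_le _ r (fun y => Num.max 0 (L ^+ 4 - y ^+ 4))
    (L ^+ 4) 0 (-1) (L ^+ 4) 0 (-1) (L ^- 2) _ 100 hr wc).
  - move=> y; apply: (@continuous_max _ _ (fun=> 0) (fun y : R => L ^+ 4 - y ^+ 4)).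
      exact: cst_continuous.
    by apply: cvgB; [exact: cst_continuous|exact: cX].
  - exists (L ^+ 4) => y; rewrite ger0_norm ?le_max ?lexx //.
    by rewrite ge_max exprn_ge0 ?(ltW L0) //= lerBlDr lerDl exprn_even_ge0.
  - by move=> y; rewrite le_max lexx.
  - move=> y /andP[ry yr]; rewrite max_r; first by ring.
    have y2 : y ^+ 2 <= L ^+ 2 by nra.
    rewrite subr_ge0 (exprM y 2 2) (exprM L 2 2).
    by rewrite ler_pXn2r ?nnegrE ?sqr_ge0.
  - move=> y; rewrite mul0r addr0 mulN1r.
    set u := y ^+ 2; have u0 : 0 <= u by exact: sqr_ge0.
    have -> : y ^+ 6 = u ^+ 3 by rewrite -exprM.
    have -> : y ^+ 4 = u ^+ 2 by rewrite -exprM.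
    have v0 : 0 < L ^+ 2 by rewrite exprn_gt0.
    have L4 : L ^+ 4 = (L ^+ 2) ^+ 2 by rewrite -exprM.
    move: (L ^+ 2) v0 L4 => v v0 ->.
    have w0 : 0 <= v^-1 * u ^+ 3.
      by apply: mulr_ge0; [rewrite invr_ge0 ltW|exact: exprn_ge0].
    rewrite ge_max lerDl w0 andbT.
    have [uv|vu] := leP u v; first by nra.
    have : u ^+ 2 <= v^-1 * u ^+ 3.
      rewrite ler_pdivlMl // (exprS u 2).
      by apply: ler_wpM2r; [exact: sqr_ge0|exact: ltW].
    by have := sqr_ge0 v; lra.
  - move=> N N100; have N0 : (0 < N)%N by lia.
    rewrite mul0r addr0 mulN1r; apply: lerD.
      by rewrite lerD2l lerN2 mean_moment2_ge // ltnW.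
    by rewrite mulrC ler_wpM2r ?mean_moment3_le // invr_ge0 exprn_ge0 // ltW.
have C_small : moment6_bound / L ^+ 2 < (96%:R)^-1 :> R.
  rewrite ltr_pdivrMr ?exprn_gt0 //; apply: (@lt_le_trans _ _ (96^-1 * 10 ^+ 10)).
    by rewrite /moment6_bound; lra.
  by rewrite ler_wpM2l.
have : r ^+ 4 <= 4.
  by rewrite (exprM r 2 2); nra.
by lra.
Qed.
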